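(* Let $H\in(0,1)\setminus\{1/2\}$ and $p=1/H$, and let $X^H$ be the random signed Takagi--Landsberg bridge of index $H$. There is a fixed deterministic refining sequence $\pi^H=(\pi^H_n)_{n\ge1}$ of finite partitions of $[0,1]$ with vanishing mesh such that $[X^H]^{(p)}_{(\pi^H_n)}$ fails to converge almost surely. Hence $X^H$ does not admit continuous critical $p$-th variation along $\pi^H$. More precisely, for some integer $r=r(H)\ge1$, let $$\mathbb V^{(r)}_n:=\mathbb T_n\cup\left\{2^{-n}(k+2^{-r}):0\le k<2^n\right\}.$$ There is a deterministic constant $C_r(H)$ such that, almost surely, $$[X^H]^{(p)}_{(\mathbb V^{(r)}_n)}\longrightarrow C_r(H)\qquad(n\to\infty),$$ and $$C_r(H)>C_{\mathrm{dyad}}(H)\ \text{ if }H<\tfrac12,\qquad C_r(H)<C_{\mathrm{dyad}}(H)\ \text{ if }H>\tfrac12 .$$ With such an $r$ fixed, one may take, for $j\ge1$, $$\pi^H_{2j-1}:=\mathbb V^{(r)}_{jr},\qquad \pi^H_{2j}:=\mathbb T_{(j+1)r}.$$ The odd terminal sums $[X^H]^{(p)}_{(\pi^H_{2j-1})}$ then converge almost surely to $C_r(H)$ and the even terminal sums $[X^H]^{(p)}_{(\pi^H_{2j})}$ to $C_{\mathrm{dyad}}(H)$.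
   Context: Faber--Schauder functions: for $n\ge0$ and $0\le k<2^n$, $e_{n,k}(t)=2^{-n/2}e_{0,0}(2^nt-k)$, where $e_{0,0}(u)=\max\{0,\min(u,1-u)\}$. Let $\{\theta_{n,k}\}$ be independent Rademacher random variables ($\pm1$ with probability $1/2$ each). For $H\in(0,1)$ the random signed Takagi--Landsberg bridge of index $H$ is $$X^H_t=\sum_{n=0}^\infty2^{n(1/2-H)}\sum_{k=0}^{2^n-1}\theta_{n,k}e_{n,k}(t),\qquad0\le t\le1,$$ where the series converges uniformly for every choice of signs. Dyadic grids: $\mathbb T_n=\{k2^{-n}:0\le k\le2^n\}$. Dyadic constant: $C_{\mathrm{dyad}}(H):=2^{1-p}\,\mathbb E|Z_H|^p$ with $p=1/H$, where $Z_H:=\sum_{m=0}^\infty2^{m(H-1)}Y_m$ and $(Y_m)_{m\ge0}$ is an independent Rademacher sequence. A finite partition of $[0,1]$ is a set $\tau=\{0=t_0<\cdots<t_N=1\}$, with $\operatorname{mesh}(\tau)=\max_i(t_{i+1}-t_i)$. For continuous $x$ and $p\ge1$, $$[x]^{(p)}_{(\tau)}(t)=\sum_{i=0}^{N-1}|x(t_{i+1}\wedge t)-x(t_i\wedge t)|^p,\qquad[x]^{(p)}_{(\tau)}:=[x]^{(p)}_{(\tau)}(1).$$ A sequence $(\pi_n)$ is refining if $\pi_n\subseteq\pi_{n+1}$ for every $n$. A continuous path $x$ has continuous $p$-th variation along a sequence $(\pi_n)$ with vanishing mesh if $[x]^{(p)}_{(\pi_n)}(t)$ converges uniformly in $t\in[0,1]$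 to a continuous function; ''critical'' refers to the exponent $p=1/H$. The failure of convergence and of continuous critical $p$-th variation are almost-sure statements. *)

(* Defs.v *)
From HB Require Import structures.
From mathcomp Require Import all_boot all_order all_algebra finmap.
From mathcomp Require Import all_classical all_reals all_analysis.

Set Implicit Arguments.
Unset Strict Implicit.
Unset Printing Implicit Defensive.

Import Order.TTheory GRing.Theory Num.Theory.
Import numFieldNormedType.Exports.

Local Open Scope classical_set_scope.
Local Open Scope ring_scope.

Definition independent_RVs {R : realType} {d : measure_display}
    {T : measurableType d} (P : probability T R) (I : choiceType)
    (X : I -> {RV P >-> R}) : Prop :=
  forall (J : {fset I}) (A : I -> set R), (forall i, measurable (A i)) ->
    P (\bigcap_(i in [set` J]) (X i @^-1` A i)) =
    (\prod_(i <- J) P (X i @^-1` A i))%E.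

Definition rademacher {R : realType} {d : measure_display}
    {T : measurableType d} (P : probability T R) (Y : {RV P >-> R}) : Prop :=
  P (Y @^-1` [set 1]) = (2^-1)%:E /\ P (Y @^-1` [set -1]) = (2^-1)%:E.

Definition rademacher_family {R : realType} {d : measure_display}
    {T : measurableType d} (P : probability T R) (I : choiceType)
    (X : I -> {RV P >-> R}) : Prop :=
  independent_RVs X /\ forall i, rademacher (X i).

Definition schauder00 {R : realType} (u : R) : R :=
  Num.max 0 (Num.min u (1 - u)).

Definition schauder {R : realType} (n k : nat) (t : R) : R :=
  2 `^ (- (n%:R / 2)) * schauder00 (2 ^+ n * t - k%:R).

(* The index set {(n, k) : 0 <= k < 2^n} is {n & 'I_(2 ^ n)}. *)
Definition rademacher_signs {R : realType} {d : measure_display}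
    {T : measurableType d} (P : probability T R)
    (theta : forall n : nat, 'I_(2 ^ n) -> {RV P >-> R}) : Prop :=
  rademacher_family
    (fun i : {n : nat & 'I_(2 ^ n)} => theta (tag i) (tagged i)).

Definition takagi_bridge {R : realType} {d : measure_display}
    {T : measurableType d} (P : probability T R) (H : R)
    (theta : forall n : nat, 'I_(2 ^ n) -> {RV P >-> R}) (w : T) (t : R) : R :=
  limn (series (fun n : nat =>
    2 `^ (n%:R * (1 / 2 - H)) *
    \sum_(k < 2 ^ n) theta n k w * schauder n k t)).

Definition dyad_series {R : realType} {d : measure_display}
    {T : measurableType d} (P : probability T R) (H : R)
    (Y : nat -> {RV P >-> R}) (w : T) : R :=
  limn (series (fun m : nat => 2 `^ (m%:R * (H - 1)) * Y m w)).

(* For a Rademacher sequence Y, [C_dyad H Y] depends on H only. *)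
Definition C_dyad {R : realType} {d : measure_display}
    {T : measurableType d} (P : probability T R) (H : R)
    (Y : nat -> {RV P >-> R}) : R :=
  let p := H^-1 in
  2 `^ (1 - p) * fine ('E_P[fun w => (`|dyad_series H Y w| `^ p)%R])%E.

(* A partition is a finite set; t_0 < ... < t_N is its sorted enumeration. *)
Definition is_partition {R : realType} (tau : {fset R}) : Prop :=
  [/\ 0 \in tau, 1 \in tau & forall t, t \in tau -> 0 <= t <= 1].

Definition pt {R : realType} (tau : {fset R}) (i : nat) : R :=
  nth 0 (sort <=%R (enum_fset tau)) i.

Definition mesh {R : realType} (tau : {fset R}) : R :=
  \big[Num.max/0]_(i < #|` tau|.-1) (pt tau i.+1 - pt tau i).

Definition pvar {R : realType} (p : R) (x : R -> R) (tau : {fset R}) (t : R)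
    : R :=
  \sum_(i < #|` tau|.-1)
    `|x (Num.min (pt tau i.+1) t) - x (Num.min (pt tau i) t)| `^ p.

Definition terminal_pvar {R : realType} (p : R) (x : R -> R) (tau : {fset R})
    : R :=
  pvar p x tau 1.

(* Continuity of x and vanishing mesh are the standing assumptions under which
   this is used; they are not conjuncts, so that its negation is not met by
   their mere failure. *)
Definition has_continuous_pvar {R : realType} (p : R) (x : R -> R)
    (pi_ : nat -> {fset R}) : Prop :=
  exists2 v : R -> R, {within `[0, 1], continuous v} &
    {uniform `[0, 1], (fun n => pvar p x (pi_ n)) @ \oo --> v}.

(* Sequences of partitions are indexed by n >= 1; the value at 0 is ignored. *)
Definition refining {R : realType} (pi_ : nat -> {fset R}) : Prop :=
  forall n : nat, (1 <= n)%N -> (pi_ n `<=` pi_ n.+1)%fset.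

Definition dyadic_grid {R : realType} (n : nat) : {fset R} :=
  [fset (nat_of_ord k)%:R * 2 ^- n | k in 'I_(2 ^ n).+1]%fset.

Definition shifted_grid {R : realType} (r n : nat) : {fset R} :=
  (dyadic_grid n `|`
   [fset 2 ^- n * ((nat_of_ord k)%:R + 2 ^- r) | k in 'I_(2 ^ n)])%fset.

(* Main.v *)
Require Import Defs.
From HB Require Import structures.
From mathcomp Require Import all_boot all_order all_algebra finmap.
From mathcomp Require Import all_classical all_reals all_analysis.
From mathcomp Require Import measurable_realfun.
From mathcomp Require Import ring lra zify.

Set Implicit Arguments.
Unset Strict Implicit.
Unset Printing Implicit Defensive.

Import Order.TTheory GRing.Theory Num.Theory.
Import numFieldNormedType.Exports.

Local Open Scope classical_set_scope.
Local Open Scope ring_scope.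

(** Write a = 2^(H-1), p = 1/H, e = 2^-r, and consider the averaging operator
    (T f)(u) = (f (1 + a u) + f (-1 + a u)) / 2 ([signavg]).  Since
    iter n T f 0 is the mean of f over the 2^n signed sums +-1 +-a ... +-a^(n-1),
    it converges, for Lipschitz f, to the expectation of f (Z_H).

    Dyadic sums.  The increment of the bridge over [k 2^-n, (k+1) 2^-n] is
    2^(-nH) a U_n(k), where U_n(k) follows the recursion U_{n+1}(2j) = s + a U_n(j)
    and U_{n+1}(2j+1) = -s + a U_n(j), s being the sign attached to the parent
    interval ([bridge_increment]).  The two children of an interval carry opposite
    signs, so, whatever the signs are, 2^-n sum_k f (U_n(k)) = iter n T f 0
    ([slope_mean]): the dyadic p-th variation of the bridge is deterministic, and
    it tends to C_dyad ([C_dyadE]).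

    Shifted sums.  Over the cell k the grid with the extra points
    2^-n (k + e) contributes 2^(1-p) 2^-n times
    G(u, v) = e |v|^p + |u - 2^(-rH) v|^p, with u = U_n(k) and
    v = U_{n+r}(2^r k) ([pvar_shifted_grid]).  Given u, the value v only involves
    the r signs on the left edge below the cell, and these are fresh and
    independent from cell to cell.  The mean of G over them is g(u) = T^r (G u) u
    ([cell_mean]), the average of g over the cells is again deterministic, and
    the deviations G - g of distinct cells are orthogonal.  The variance of the
    sum is therefore O(2^-n), which is summable, and almost surely the sums
    converge to C_r = 2^(1-p) E g(Z_H) ([ae_cvg_terminal_pvar_shifted_grid]).

    Comparison.  Up to the factor 2^(1-p), g(u) averages to
    e E|Z|^p + E |(1 - e) Z - e^H W|^p where W is a symmetric signed sum
    independent of Z.  As e -> 0 the perturbation adds a second order term of size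
    e^(2H), while shrinking Z to (1 - e) Z loses (p - 1) e E|Z|^p net of the first
    summand.  For H < 1/2 the gain wins and C_r > C_dyad.  For H > 1/2 the loss
    wins and C_r < C_dyad; here |.|^p is not twice differentiable at 0, and the
    region |Z| < delta is handled by an anti-concentration bound
    ([signavg_anticoncentration]).  In both cases a large r works
    ([exists_cell_moment_neq]), and interlacing the two families of grids gives
    a refining sequence whose sums have two distinct limit points. *)

(** * The signed averaging operator *)

(** The n-th iterate at u is the mean of f over the values
    +-1 +-a ... +-a^(n-1) + a^n u, all sign patterns being equally likely; working
    with iterates avoids any enumeration of the patterns. *)
Definition signavg {R : realType} (a : R) (f : R -> R) (u : R) : R :=
  (f (1 + a * u) + f (- 1 + a * u)) / 2.

Section Signavg.
Context {R : realType}.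
Variable a : R.
Local Notation T := (signavg a).

Lemma iter_signavg_cst n c u : iter n T (fun=> c) u = c.
Proof. by elim: n u => //= n IH u; rewrite /signavg !IH; lra. Qed.

Lemma iter_signavg_lin n f g (c d : R) u :
  iter n T (fun v => c * f v + d * g v) u = c * iter n T f u + d * iter n T g u.
Proof. by elim: n u => //= n IH u; rewrite /signavg !IH; lra. Qed.

(** The starting point is damped by a^n, so moving it amounts to a translation
    of the integrand by a^n times as much. *)
Lemma iter_signavg_shift n f c u :
  iter n T (fun v => f (v + a ^+ n * c)) u = iter n T f (u + c).
Proof.
elim: n c u => [|n IH] c u /=; first by rewrite expr0 mul1r.
have -> : (fun v => f (v + a ^+ n.+1 * c)) = (fun v => f (v + a ^+ n * (a * c))).
  by apply/funext => v; rewrite exprSr mulrA.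
by rewrite /signavg !IH; congr ((iter n _ f _ + iter n _ f _) / 2); ring.
Qed.

Lemma iter_signavg_opp n f u :
  iter n T (fun v => f (- v)) u = iter n T f (- u).
Proof.
elim: n u => //= n IH u; rewrite /signavg !IH addrC.
by congr ((iter n _ f _ + iter n _ f _) / 2); ring.
Qed.

Lemma iter_signavg_sum n (I : Type) (s : seq I) (f : I -> R -> R) u :
  iter n T (fun v => \sum_(i <- s) f i v) u = \sum_(i <- s) iter n T (f i) u.
Proof.
elim: n u => //= n IH u; rewrite /signavg !IH -big_split /= mulr_suml.
by [].
Qed.

Hypotheses (a0 : 0 < a) (a1 : a < 1).
Local Notation B := (1 - a)^-1.

Lemma signs_bound_gt0 : 0 < B. Proof. by rewrite invr_gt0 subr_gt0. Qed.

Lemma signs_bound_rec : 1 + a * B = B.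
Proof. by have := a1; move=> ?; field; rewrite gt_eqF// subr_gt0. Qed.

(** The interval [-B, B] with B = 1/(1-a) contains every signed geometric sum; it
    is invariant under both branches u |-> +-1 + a u. *)
Lemma signs_bound_stable u : `|u| <= B -> `|1 + a * u| <= B /\ `|- 1 + a * u| <= B.
Proof.
move=> uB; have auB : `|a * u| <= a * B by rewrite normrM gtr0_norm// ler_pM2l.
by rewrite -signs_bound_rec; split; apply: le_trans (ler_normD _ _) _;
  rewrite ?normrN normr1 lerD2l.
Qed.

Lemma le_iter_signavg n f g : (forall u, `|u| <= B -> f u <= g u) ->
  forall u, `|u| <= B -> iter n T f u <= iter n T g u.
Proof.
move=> fg; elim: n => //= n IH u /signs_bound_stable[u1 u2].
by rewrite /signavg ler_pM2r ?invr_gt0// lerD ?IH.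
Qed.

Lemma iter_signavg_dist n f g (c : R) :
  (forall u, `|u| <= B -> `|f u - g u| <= c) ->
  forall u, `|u| <= B -> `|iter n T f u - iter n T g u| <= c.
Proof.
move=> fg; elim: n => //= n IH u /signs_bound_stable[u1 u2].
have := IH _ u1; have := IH _ u2; rewrite /signavg !ler_norml.
by move=> /andP[? ?] /andP[? ?]; apply/andP; split; lra.
Qed.

(** Each branch contracts distances by a. *)
Lemma iter_signavg_lip n f (L : R) :
  (forall u v, `|u| <= B -> `|v| <= B -> `|f u - f v| <= L * `|u - v|) ->
  forall u v, `|u| <= B -> `|v| <= B ->
    `|iter n T f u - iter n T f v| <= a ^+ n * L * `|u - v|.
Proof.
move=> Lf; elim: n => [|n IH] u v /=; first by rewrite expr0 mul1r; exact: Lf.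
move=> /signs_bound_stable[u1 u2] /signs_bound_stable[v1 v2].
have := IH _ _ u1 v1; have := IH _ _ u2 v2; rewrite /signavg.
have e1 : 1 + a * u - (1 + a * v) = a * (u - v) by ring.
have e2 : -1 + a * u - (-1 + a * v) = a * (u - v) by ring.
rewrite e1 e2 normrM gtr0_norm// !ler_norml exprS => /andP[? ?] /andP[? ?].
by apply/andP; split; lra.
Qed.

Lemma abs1_le_bound : `|1| <= B.
Proof.
by rewrite normr1 invf_ge1 ?subr_gt0// lerBlDr lerDl ltW.
Qed.

(** The iterate n+1 at 0 averages the iterate n over +-1, so by contraction the
    successive values differ by at most a^n times the Lipschitz constant. *)
Lemma is_cvg_signavg f (L : R) :
  (forall u v, `|u| <= B -> `|v| <= B -> `|f u - f v| <= L * `|u - v|) ->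
  cvgn (fun n => iter n T f 0).
Proof.
move=> Lf.
have B1 := abs1_le_bound.
have L0 : 0 <= L.
  have := Lf 1 0 B1; rewrite normr0 subr0 normr1 mulr1 => /(_ (ltW signs_bound_gt0)).
  exact: le_trans.
pose u_ := fun n => iter n T f 0.
have step n : `|u_ n.+1 - u_ n| <= geometric L a n.
  have n0 : `|0 : R| <= B by rewrite normr0 ltW// signs_bound_gt0.
  have n1 : `|- 1 : R| <= B by rewrite normrN.
  have := iter_signavg_lip n Lf B1 n0; have := iter_signavg_lip n Lf n1 n0.
  rewrite /u_ iterS {5}/signavg mulr0 !addr0 !subr0 normrN normr1 mulr1 /=.
  rewrite !ler_norml [L * _]mulrC => /andP[? ?] /andP[? ?].
  by apply/andP; split; lra.
have : cvgn (series (fun n => u_ n.+1 - u_ n)).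
  apply: normed_cvg; apply: (@series_le_cvg _ _ (geometric L a)) => //.
  - by move=> n /=.
  - by move=> n; rewrite /geometric /= mulr_ge0// exprn_ge0// ltW.
  - by apply: is_cvg_geometric_series; rewrite gtr0_norm.
have -> : series (fun n => u_ n.+1 - u_ n) = (fun n => u_ n - u_ 0).
  by apply/funext => n; rewrite /series /= telescope_sumr.
move=> h; rewrite (_ : (fun n => _) = (fun n => u_ n - u_ 0) \+ cst (u_ 0)).
  by apply: is_cvgD => //; apply: is_cvg_cst.
by apply/funext => n /=; rewrite subrK.
Qed.

(** A signed sum Z of length n >= N satisfies N P(|Z| < del) <= 2 for some del
    depending on N only.  Flipping the i-th sign from -1 to 1 moves Z by 2 a^i, so
    P(|Z - 2 a^i| < del) >= P(|Z| < del, i-th sign = -1) = P(|Z| < del) / 2 by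
    symmetry; and the N intervals around the points 2 a^i, i < N, are pairwise
    disjoint once del is below the gaps. *)
Lemma signavg_anticoncentration (N : nat) :
  exists2 del : R, 0 < del & forall n, (N <= n)%N ->
   iter n T (fun u => (`|u| < del)%R%:R) 0 * N%:R <= 2.
Proof.
(* the gap between 2 a^i and 2 a^j, i < j < N, is at least 2 a^i (1 - a) *)
exists (a ^+ N * (1 - a)); first by rewrite mulr_gt0 ?exprn_gt0 ?subr_gt0.
set del := _ * _ => n Nn; set I := fun u : R => (`|u| < del)%R%:R : R.
have I0 u : 0 <= I u by rewrite /I ler0n.
have Ipos k u : 0 <= iter k T I u.
  by elim: k u => //= k IH u; rewrite /signavg mulr_ge0// addr_ge0.
have Isym k u : iter k T I (- u) = iter k T I u.
  rewrite -iter_signavg_opp; congr (iter k T _ u).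
  by apply/funext => v; rewrite /I normrN.
have Hsym k f : (forall u, f (- u) = f u) -> forall u, iter k T f (-u) = iter k T f u.
  by move=> fN u; rewrite -iter_signavg_opp; congr (iter k T _ u); apply/funext.
have mono k f g : (forall u, f u <= g u) -> forall u, iter k T f u <= iter k T g u.
  move=> fg; elim: k => //= k IH u.
  by rewrite /signavg ler_pM2r ?invr_gt0// lerD ?IH.
have key i : (i < n)%N ->
    iter n T I 0 <= 2 * iter n T (fun u => I (u - 2 * a ^+ i)) 0.
  move=> lt_in; pose m := (n - i.+1)%N.
  have nE f : iter n T f 0 = iter m T (T (iter i T f)) 0.
    by rewrite -iterS -iterD /m subnK.
  pose Jp u := iter i T I (1 + a * u); pose Jm u := iter i T I (- 1 + a * u).
  have JpN u : Jp (- u) = Jm u.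
    by rewrite /Jp /Jm -Isym; congr (iter i T I _); ring.
  (* Jp and Jm fix the i-th sign to 1 and -1; by symmetry they have the same mean *)
  have e1 : iter m T Jp 0 = iter m T Jm 0.
    rewrite -{1}oppr0 -iter_signavg_opp; congr (iter m T _ 0).
    by apply/funext => u; rewrite JpN.
  have -> : iter n T I 0 = iter m T Jm 0.
    rewrite nE (_ : T (iter i T I) = fun u => 2^-1 * Jp u + 2^-1 * Jm u).
      by rewrite iter_signavg_lin e1; lra.
    by apply/funext => u; rewrite /signavg /Jp /Jm; lra.
  rewrite nE -[2 * _]addr0 -[X in _ + X](mulr0 0) -[X in _ + 0 * X](iter_signavg_cst m 0 0).
  rewrite -iter_signavg_lin; apply: mono => u.
  rewrite mul0r addr0 /signavg mulrC divfK //.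
  have sh v : iter i T (fun w => I (w - 2 * a ^+ i)) v = iter i T I (v - 2).
    rewrite -iter_signavg_shift; congr (iter i T _ v).
    by apply/funext => w; rewrite mulrN [a ^+ i * _]mulrC.
  rewrite !sh (_ : 1 + a * u - 2 = -1 + a * u); last by ring.
  by rewrite lerDl Ipos.
have : N%:R * iter n T I 0 <=
    2 * iter n T (fun u => \sum_(i <- index_iota 0 N) I (u - 2 * a ^+ i)) 0.
  rewrite iter_signavg_sum mulr_sumr mulrC.
  rewrite (_ : _ * N%:R = \sum_(i <- index_iota 0 N) iter n T I 0); last first.
    by rewrite big_const_nat subn0 iter_addr_0 mulr_natr.
  rewrite !big_mkord; apply: ler_sum => i _; apply: key.
  exact: leq_trans (ltn_ord i) Nn.
rewrite mulrC => /le_trans; apply.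
rewrite -[leRHS]mulr1 ler_pM2l// -[leRHS](iter_signavg_cst n 1 0).
apply: mono => u; rewrite big_mkord.
have [i iu|] := pickP (fun i : 'I_N => `|u - 2 * a ^+ i| < del); last first.
  by move=> no; rewrite big1// => i _; rewrite /I no.
rewrite (bigD1 i)//= big1 ?addr0 => [|j ji]; first by rewrite /I; case: ltP.
have sep (x y : nat) : (x < y < N)%N -> 2 * del <= 2 * a ^+ x - 2 * a ^+ y.
  move=> /andP[xy yN]; rewrite -mulrBr ler_pM2l//.
  apply: (@le_trans _ _ (a ^+ x * (1 - a))).
    rewrite ler_pM2r ?subr_gt0//; apply: ler_wiXn2l; rewrite ?ltW//.
    exact: ltnW (ltn_trans xy yN).
  by rewrite mulrBr mulr1 lerD2l lerN2 -exprSr ler_wiXn2l ?ltW.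
rewrite /I; case: (ltP `|u - 2 * a ^+ j|) => // ju; exfalso.
move: iu ju; rewrite !ltr_norml => /andP[? ?] /andP[? ?].
have := ji; rewrite -val_eqE neq_ltn => /orP[] lt_.
- by have := sep j i; rewrite lt_ ltn_ord => /(_ isT); lra.
- by have := sep i j; rewrite lt_ ltn_ord => /(_ isT); lra.
Qed.

End Signavg.

(** * Inequalities between powers *)

Section PowerInequalities.
Context {R : realType}.
Implicit Types (p q x y w : R).

(** Bernoulli's inequality for exponents in [0, 1]: convexity of the exponential
    between 0 and ln y. *)
Lemma powR_bernoulli_le y q : 0 <= y -> 0 <= q <= 1 ->
  y `^ q <= 1 + q * (y - 1).
Proof.
move=> y0 /andP[q0 q1]; move: y0; rewrite le_eqVlt => /predU1P[<-|y0].
  have [->|qn] := eqVneq q 0; rewrite ?powRr0 ?powR0 //; lra.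
have := convex_expR (Itv01 q0 q1) (ln y : R^o) (0 : R^o).
rewrite !convRE /= expR0 lnK ?posrE// /powR gt_eqF//.
rewrite mulr0 addr0 ?mulr1; move=> /le_trans; apply; rewrite /unstable.onem; lra.
Qed.

(** Bernoulli's inequality for exponents at least 1, from the previous one applied
    to the exponent 1/p and the base 1 + p (y - 1). *)
Lemma powR_bernoulli_ge y p : 0 <= y -> 1 <= p ->
  1 + p * (y - 1) <= y `^ p.
Proof.
move=> y0 p1; have p0 : 0 < p by exact: lt_le_trans p1.
have [neg|pos] := leP (1 + p * (y - 1)) 0.
  exact: le_trans neg (powR_ge0 _ _).
have iv : 0 <= p^-1 <= 1 by rewrite invr_ge0 ltW//= invf_le1.
have := powR_bernoulli_le (ltW pos) iv.
have -> : 1 + p^-1 * (1 + p * (y - 1) - 1) = y.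
  by field; rewrite gt_eqF.
move=> h; have := ge0_ler_powR (ltW p0) (powR_ge0 _ _ : _ \is Num.nneg)
  (y0 : _ \is Num.nneg) h.
by rewrite -powRrM mulVf ?gt_eqF// powRr1// ltW.
Qed.

(** Bernoulli at x/s and y/s, s the midpoint: the linear terms cancel. *)
Lemma powR_midpoint_ge x y q : 0 <= x -> 0 <= y -> 1 <= q ->
  ((x + y) / 2) `^ q <= (x `^ q + y `^ q) / 2.
Proof.
move=> x0 y0 q1; set s := (x + y) / 2.
have s0 : 0 <= s by rewrite /s; lra.
have q0 : 0 < q by exact: lt_le_trans q1.
move: s0; rewrite le_eqVlt => /predU1P[s0|s0].
  by rewrite -s0 powR0 ?gt_eqF// divr_ge0// addr_ge0// powR_ge0.
have xs0 : 0 <= x / s by rewrite divr_ge0// ltW.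
have ys0 : 0 <= y / s by rewrite divr_ge0// ltW.
have ex : x `^ q = s `^ q * (x / s) `^ q.
  by rewrite -(powRM _ (ltW s0) xs0) mulrC divfK// gt_eqF.
have ey : y `^ q = s `^ q * (y / s) `^ q.
  by rewrite -(powRM _ (ltW s0) ys0) mulrC divfK// gt_eqF.
have := powR_bernoulli_ge xs0 q1; have := powR_bernoulli_ge ys0 q1.
have e : y / s = 2 - x / s by rewrite /s; field; rewrite gt_eqF//; move: s0; rewrite /s; lra.
rewrite ex ey -mulrDr -mulrA ler_pMr ?powR_gt0// {1}e => ? ?.
by rewrite ler_pdivlMr// mul1r; lra.
Qed.

Lemma powR_midpoint_le x y q : 0 <= x -> 0 <= y -> 0 < q <= 1 ->
  (x `^ q + y `^ q) / 2 <= ((x + y) / 2) `^ q.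
Proof.
move=> x0 y0 /andP[q0 q1].
have := @powR_midpoint_ge (x `^ q) (y `^ q) q^-1 (powR_ge0 _ _) (powR_ge0 _ _).
rewrite -!powRrM mulfV ?gt_eqF// !powRr1// invf_ge1// => /(_ q1) h.
have h0 : 0 <= (x `^ q + y `^ q) / 2 by rewrite divr_ge0// addr_ge0// powR_ge0.
have := ge0_ler_powR (ltW q0) (powR_ge0 _ _ : _ \is Num.nneg) _ h.
rewrite -powRrM mulVf ?gt_eqF// powRr1//; apply; rewrite nnegrE; lra.
Qed.

Lemma normr_powR_sqr x p : `|x| `^ p = (x ^+ 2) `^ (p / 2).
Proof.
rewrite -real_normK ?num_real// -powR_mulrn// -powRrM; congr (_ `^ _); lra.
Qed.

(** By the parallelogram identity x^2 + w^2 is the midpoint of (x + w)^2 and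
    (x - w)^2, so this is midpoint convexity of the power p/2. *)
Lemma powR_parallelogram_ge x w p : 2 <= p ->
  (x ^+ 2 + w ^+ 2) `^ (p / 2) <= (`|x + w| `^ p + `|x - w| `^ p) / 2.
Proof.
move=> p2; rewrite !normr_powR_sqr.
have -> : x ^+ 2 + w ^+ 2 = ((x + w) ^+ 2 + (x - w) ^+ 2) / 2 by field.
by apply: powR_midpoint_ge; rewrite ?sqr_ge0//; lra.
Qed.

Lemma powR_parallelogram_le x w p : 0 < p <= 2 ->
  (`|x + w| `^ p + `|x - w| `^ p) / 2 <= (x ^+ 2 + w ^+ 2) `^ (p / 2).
Proof.
move=> p2; rewrite !normr_powR_sqr.
have -> : x ^+ 2 + w ^+ 2 = ((x + w) ^+ 2 + (x - w) ^+ 2) / 2 by field.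
by apply: powR_midpoint_le; rewrite ?sqr_ge0//; lra.
Qed.

Lemma normr_powR_lip p (M u v : R) : 1 <= p -> `|u| <= M -> `|v| <= M ->
  `| `|u| `^ p - `|v| `^ p | <= p * M `^ (p - 1) * `|u - v|.
Proof.
move=> p1.
have p0 : 0 < p by exact: lt_le_trans p1.
wlog uv : u v / `|u| <= `|v|.
  move=> wl uM vM; have [/wl|/ltW/wl] := leP `|u| `|v|; first exact.
  by move=> h; rewrite distrC [X in _ <= _ * X]distrC; exact: h.
move=> uM vM.
rewrite distrC ger0_norm; last first.
  by rewrite subr_ge0 ge0_ler_powR ?nnegrE// ltW.
have dist : `|v| - `|u| <= `|u - v| by rewrite distrC; exact: lerB_dist.
have [v0|v0] := eqVneq v 0.
  have -> : u = 0 by apply/eqP; rewrite -normr_le0 -(normr0 R) -v0.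
  by rewrite v0 !subrr normr0 mulr0.
have nv : 0 < `|v| by rewrite normr_gt0.
have := @powR_bernoulli_ge (`|u| / `|v|) p (divr_ge0 (normr_ge0 _) (normr_ge0 _)) p1.
have eu : `|u| `^ p = `|v| `^ p * (`|u| / `|v|) `^ p.
  by rewrite -powRM ?divr_ge0// mulrC divfK// gt_eqF.
have ev : `|v| `^ p = `|v| `^ (p - 1) * `|v|.
  rewrite -{3}(powRr1 (normr_ge0 v)) -powRD ?subrK//.
  by rewrite normr_eq0 v0 implybT.
move=> h; rewrite eu -{1}(mulr1 (_ `^ p)) -mulrBr.
apply: (@le_trans _ _ (`|v| `^ p * (p * (1 - `|u| / `|v|)))).
  by rewrite ler_wpM2l ?powR_ge0//; lra.
rewrite ev (_ : _ * _ * _ = p * `|v| `^ (p - 1) * (`|v| - `|u|)); last first.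
  by field; rewrite gt_eqF.
apply: ler_pM => //; rewrite ?subr_ge0//.
- by rewrite mulr_ge0 ?powR_ge0// ltW.
- rewrite ler_pM2l// ge0_ler_powR ?nnegrE ?subr_ge0//.
  exact: le_trans vM.
Qed.

Lemma powR_subadd x y q : 0 <= x -> 0 <= y -> 0 < q <= 1 ->
  (x + y) `^ q <= x `^ q + y `^ q.
Proof.
move=> x0 y0 /andP[q0 q1].
have [s0|s0] := eqVneq (x + y) 0.
  by rewrite s0 powR0 ?gt_eqF// addr_ge0// powR_ge0.
have s : 0 < x + y by rewrite lt_def s0 addr_ge0.
have frac z : 0 <= z <= 1 -> z <= z `^ q.
  move=> /andP[]; rewrite le_eqVlt => /predU1P[<-|z0 z1].
    by rewrite powR_ge0.
  rewrite -{1}(powRr1 (ltW z0)); apply: ger_powR => //.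
  by rewrite z0.
have fx : 0 <= x / (x + y) <= 1.
  by rewrite (divr_ge0 x0 (ltW s))/= ler_pdivrMr// mul1r lerDl.
have fy : 0 <= y / (x + y) <= 1.
  by rewrite (divr_ge0 y0 (ltW s))/= ler_pdivrMr// mul1r lerDr.
have ex z : 0 <= z -> z `^ q = (x + y) `^ q * (z / (x + y)) `^ q.
  by move=> z0; rewrite -(powRM _ (ltW s) (divr_ge0 z0 (ltW s))) mulrC divfK// gt_eqF.
rewrite (ex x)// (ex y)// -mulrDr ler_peMr ?powR_ge0//.
apply: le_trans (lerD (frac _ fx) (frac _ fy)).
by rewrite -mulrDl divff.
Qed.

End PowerInequalities.

(** * The limit constants and their comparison *)

Lemma powR2_lt1 {R : realType} (x : R) : x < 0 -> 2 `^ x < 1 :> R.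
Proof.
move=> x0; rewrite /powR gt_eqF// expR_lt1 nmulr_rlt0//.
by rewrite ln_gt0// ltr1n.
Qed.

(** Case H < 1/2: e is the length fraction 2^-r, Q stands for (1 - e)^p and k is the
    relative gain coming from the second order term, which dominates e. *)
Lemma lower_arith {R : realFieldType} (e p k Q : R) : 0 < k ->
  p * e < 2^-1 -> 1 - p * e <= Q -> (p - 1) * e < 2^-1 * k ->
  1 < e + Q * (1 + k).
Proof.
move=> k0 pe hQ hk; apply: (@lt_le_trans _ _ (e + (1 - p * e) * (1 + k))).
  have : p * e * k < 2^-1 * k by rewrite ltr_pM2r.
  lra.
by rewrite lerD2l ler_wpM2r//; lra.
Qed.

(** Case H > 1/2: Q stands for (1 - e)^p, k e for the relative second order gain and
    e X for the contribution of the neighbourhood of 0; both are small compared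
    with the loss (p - 1) e. *)
Lemma upper_arith {R : realFieldType} (e p m k Q X : R) : 0 < e < 2^-1 ->
  1 < p -> 1 <= m -> 0 <= k -> k < (p - 1) / 2 ->
  Q <= (1 - e) * (1 - (p - 1) * e) -> X < (p - 1) / 4 ->
  e * m + Q * (1 + k * e) * m + e * X < m.
Proof.
move=> /andP[e0 e1] p1 m1 k0 kp hQ hX.
have p0 : 0 <= p - 1 by lra.
have t1 : Q * (1 + k * e) <= (1 - e) * (1 - (p - 1) / 2 * e).
  apply: (@le_trans _ _ ((1 - e) * (1 - (p - 1) * e) * (1 + k * e))).
    by rewrite ler_wpM2r// addr_ge0// mulr_ge0// ltW.
  rewrite -mulrA ler_wpM2l; [by []|lra|].
  have ke : k * e <= (p - 1) / 2 * e by rewrite ler_pM2r// ltW.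
  have : 0 <= (p - 1) * e * (k * e).
    by apply: mulr_ge0; apply: mulr_ge0 => //; exact: ltW.
  lra.
have t2 : Q * (1 + k * e) * m <= (1 - e) * (1 - (p - 1) / 2 * e) * m.
  by rewrite ler_wpM2r//; lra.
have t3 : e * X < e * ((p - 1) / 4) by rewrite ltr_pM2l.
have pe0 : 0 <= e * (p - 1) by rewrite mulr_ge0// ltW.
have h5 : 2^-1 <= (1 - e) * m.
  have : (1 - e) * 1 <= (1 - e) * m by rewrite ler_wpM2l//; lra.
  lra.
by have := ler_wpM2r pe0 h5; lra.
Qed.

Section CellMean.
Context {R : realType}.
Variable H : R.
Hypothesis H01 : 0 < H < 1.
Local Notation p := H^-1.
Local Notation a := (2 `^ (H - 1) : R).
Local Notation T := (signavg a).
Local Notation B := (1 - a)^-1.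

Definition power_mean (q : R) (u : R) : R := `|u| `^ q.

(** With u and v the normalised increments over a dyadic interval and over its
    leftmost part of relative length 2^-r, this is the normalised contribution of
    the two pieces to the p-th variation. *)
Definition cell (r : nat) (u v : R) : R :=
  2 ^- r * power_mean p v + power_mean p (u - 2 `^ (- (r%:R * H)) * v).

(** Given u, the normalised increment over the leftmost part is
    a signed sum of length r started at u, hence the iterate evaluated at u. *)
Definition cell_mean (r : nat) (u : R) : R := iter r T (cell r u) u.

(** Contribution of the long piece of a cell, rewritten so that the average no longer
    starts at u: the shift turns u into (1 - 2^-r) u. *)
Let remainder (r : nat) (u : R) : R :=
  iter r T (fun v => power_mean p ((1 - 2 ^- r) * u - 2 `^ (- (r%:R * H)) * v)) 0.

Local Lemma H_gt0 : 0 < H. Proof. by case/andP: H01. Qed.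

Lemma exponent_gt1 : 1 < p.
Proof. by case/andP: H01 => ? ?; rewrite invf_gt1. Qed.

Lemma ratio_gt0 : 0 < a. Proof. by rewrite powR_gt0. Qed.

Lemma ratio_lt1 : a < 1.
Proof. by case/andP: H01 => h0 h1; rewrite powR2_lt1// subr_lt0. Qed.

Lemma exp2VnE r : 2 ^- r = 2 `^ (- r%:R) :> R.
Proof. by rewrite powRN powR_mulrn. Qed.

Lemma powR2D (x y : R) : 2 `^ x * 2 `^ y = 2 `^ (x + y) :> R.
Proof. by rewrite powRD// pnatr_eq0 implybT. Qed.

Lemma powR2X (x : R) n : (2 `^ x) ^+ n = 2 `^ (x * n%:R) :> R.
Proof. by rewrite powRrM powR_mulrn// powR_ge0. Qed.

(** The exponents are tuned so that a piece 2^r times shorter of a straight line has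
    exactly a 2^-r share of its increment. *)
Lemma scale_ratio r : 2 `^ (- (r%:R * H)) * a ^+ r = 2 ^- r :> R.
Proof. by rewrite powR2X powR2D exp2VnE; congr (_ `^ _); ring. Qed.

Lemma scale_powR r : (2 `^ (- (r%:R * H))) `^ p = 2 ^- r :> R.
Proof.
rewrite -powRrM exp2VnE; congr (_ `^ _); field.
by rewrite gt_eqF// H_gt0.
Qed.

Lemma scale_le1 r : 2 `^ (- (r%:R * H)) <= 1 :> R.
Proof.
rewrite -[leRHS](powRr0 2) ler_powR ?ler1n// oppr_le0 mulr_ge0//.
exact: ltW H_gt0.
Qed.

Lemma exp2Vn_itv r : 0 < (2 ^- r : R) <= 1.
Proof. by rewrite invr_gt0 exprn_gt0//= invf_le1 ?exprn_gt0// exprn_ege1// ler1n. Qed.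

Let power_mean_lip (u v : R) : `|u| <= 2 * B -> `|v| <= 2 * B ->
  `|power_mean p u - power_mean p v| <= p * (2 * B) `^ (p - 1) * `|u - v|.
Proof. by apply: normr_powR_lip; rewrite ltW// exponent_gt1. Qed.

Let Bgt0 : 0 < B := signs_bound_gt0 ratio_lt1.

Let B2 (u : R) : `|u| <= B -> `|u| <= 2 * B.
Proof. by move=> /le_trans; apply; have := Bgt0; lra. Qed.

Lemma power_mean_lipschitz (u v : R) : `|u| <= B -> `|v| <= B ->
  `|power_mean p u - power_mean p v| <= p * (2 * B) `^ (p - 1) * `|u - v|.
Proof. by move=> /B2 ? /B2 ?; exact: power_mean_lip. Qed.

Lemma cell_meanE r u :
  cell_mean r u = 2 ^- r * iter r T (power_mean p) u + remainder r u.
Proof.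
rewrite /cell_mean /cell.
rewrite (_ : (fun v => _) = fun v => 2 ^- r * power_mean p v +
   1 * power_mean p (u - 2 `^ (- (r%:R * H)) * v)); last first.
  by apply/funext => v; rewrite mul1r.
rewrite iter_signavg_lin mul1r; congr (_ + _).
rewrite -{2}[u]add0r -iter_signavg_shift /remainder.
congr (iter r T _ 0); apply/funext => v; congr (power_mean p _).
rewrite mulrDr mulrA scale_ratio; ring.
Qed.

Let cell_arg r (u v : R) : `|u| <= B -> `|v| <= B ->
  `|(1 - 2 ^- r) * u - 2 `^ (- (r%:R * H)) * v| <= 2 * B.
Proof.
move=> uB vB; apply: le_trans (ler_normB _ _) _.
have /andP[e0 e1] := exp2Vn_itv r.
rewrite !normrM (ger0_norm (powR_ge0 _ _)) ger0_norm ?subr_ge0//.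
have : (1 - 2 ^- r) * `|u| <= 1 * B by apply: ler_pM => //; lra.
have : 2 `^ (- (r%:R * H)) * `|v| <= 1 * B.
  by apply: ler_pM => //; exact: scale_le1.
lra.
Qed.

Lemma cell_mean_lipschitz r : exists L : R, forall u v, `|u| <= B -> `|v| <= B ->
  `|cell_mean r u - cell_mean r v| <= L * `|u - v|.
Proof.
pose L0 := p * (2 * B) `^ (p - 1); have /andP[e0 e1] := exp2Vn_itv r.
have L00 : 0 <= L0.
  by rewrite /L0 mulr_ge0 ?powR_ge0// ltW// (lt_trans _ exponent_gt1).
exists (2 ^- r * (a ^+ r * L0) + L0) => u v uB vB.
rewrite !cell_meanE.
have -> : 2 ^- r * iter r T (power_mean p) u + remainder r u -
  (2 ^- r * iter r T (power_mean p) v + remainder r v) =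
  2 ^- r * (iter r T (power_mean p) u - iter r T (power_mean p) v) +
  (remainder r u - remainder r v) by ring.
apply: le_trans (ler_normD _ _) _; rewrite mulrDl; apply: lerD.
  rewrite normrM gtr0_norm// -[leRHS]mulrA ler_pM2l//.
  apply: (iter_signavg_lip ratio_gt0 ratio_lt1) => //.
  exact: power_mean_lipschitz.
apply: (@iter_signavg_dist _ _ ratio_gt0 ratio_lt1); last first.
  by rewrite normr0 ltW.
move=> w wB; apply: le_trans (power_mean_lip (cell_arg _ uB wB) (cell_arg _ vB wB)) _.
apply: ler_wpM2l => //.
have -> : (1 - 2 ^- r) * u - 2 `^ (- (r%:R * H)) * w -
  ((1 - 2 ^- r) * v - 2 `^ (- (r%:R * H)) * w) = (1 - 2 ^- r) * (u - v) by ring.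
by rewrite normrM ler_piMl// ger0_norm ?subr_ge0//; lra.
Qed.

(** The signed sum v is symmetric, so the first order term in v disappears. *)
Let remainder_sym r u : remainder r u = iter r T (fun v =>
  (`|(1 - 2 ^- r) * u + 2 `^ (- (r%:R * H)) * v| `^ p +
   `|(1 - 2 ^- r) * u - 2 `^ (- (r%:R * H)) * v| `^ p) / 2) 0.
Proof.
rewrite (_ : (fun v => _) = fun v =>
   2^-1 * power_mean p ((1 - 2 ^- r) * u - 2 `^ (- (r%:R * H)) * (- v)) +
   2^-1 * power_mean p ((1 - 2 ^- r) * u - 2 `^ (- (r%:R * H)) * v)); last first.
  by apply/funext => v; rewrite /power_mean mulrN opprK -mulrDr mulrC.
rewrite iter_signavg_lin (@iter_signavg_opp _ a r (fun v => power_mean p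
  ((1 - 2 ^- r) * u - 2 `^ (- (r%:R * H)) * v))) oppr0 -/(remainder r u).
lra.
Qed.

Lemma iter_signavg_sqr_ge1 r : (0 < r)%N -> 1 <= iter r T (fun v => v ^+ 2) 0.
Proof.
case: r => // r _; rewrite iterSr -[leLHS](iter_signavg_cst a r 1 0).
apply: (le_iter_signavg ratio_gt0 ratio_lt1); last by rewrite normr0 ltW.
by move=> u _; rewrite /signavg; have := sqr_ge0 (a * u); nra.
Qed.

Let onem_powR r (u : R) : power_mean p ((1 - 2 ^- r) * u) =
  (1 - 2 ^- r) `^ p * power_mean p u.
Proof.
have /andP[e0 e1] := exp2Vn_itv r.
by rewrite /power_mean normrM ger0_norm ?subr_ge0// powRM ?subr_ge0.
Qed.

(** For p >= 2 the parallelogram inequality bounds the symmetrised power below by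
    (x^2 + w^2)^(p/2); as |x| <= B this is at least |x|^p (1 + w^2 / B^2), and the mean
    of v^2 is at least 1. *)
Let remainder_ge r u : H < 1 / 2 -> (0 < r)%N -> `|u| <= B ->
  (1 - 2 ^- r) `^ p * (1 + (2 `^ (- (r%:R * H))) ^+ 2 / B ^+ 2) * power_mean p u
  <= remainder r u.
Proof.
move=> Hlt r0 uB; have H0 := H_gt0; have /andP[e0 e1] := exp2Vn_itv r.
have p2 : 2 <= p by rewrite -[leLHS]invrK lef_pV2 ?posrE ?invr_gt0//; lra.
set s := 2 `^ _; set x := (1 - 2 ^- r) * u.
have xB : x ^+ 2 <= B ^+ 2.
  rewrite -real_normK ?num_real// ler_sqr ?nnegrE ?(ltW Bgt0)//.
  apply: le_trans uB; rewrite normrM ler_piMl// ger0_norm ?subr_ge0//; lra.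
rewrite remainder_sym mulrAC -onem_powR -/x.
have low v : power_mean p x * 1 + power_mean p x * (s ^+ 2 / B ^+ 2) * v ^+ 2 <=
    (`|x + s * v| `^ p + `|x - s * v| `^ p) / 2.
  apply: le_trans (powR_parallelogram_ge _ _ p2).
  have q0 : 0 <= p / 2 by lra.
  have q1 : 1 <= p / 2 by lra.
  have y0 : 0 <= (s * v) ^+ 2 / B ^+ 2 by rewrite divr_ge0// ?sqr_ge0.
  have y1 : 0 <= 1 + (s * v) ^+ 2 / B ^+ 2 by lra.
  apply: (@le_trans _ _ ((x ^+ 2 * (1 + (s * v) ^+ 2 / B ^+ 2)) `^ (p / 2))).
    rewrite powRM ?sqr_ge0// -normr_powR_sqr -/(power_mean p x).
    rewrite -mulrA -mulrDr ler_wpM2l ?powR_ge0//.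
    apply: le_trans (powR_bernoulli_ge y1 q1).
    rewrite lerD2l addrAC subrr add0r exprMn mulrAC.
    by rewrite ler_peMl// -exprMn.
  apply: ge0_ler_powR => //.
  - by rewrite nnegrE mulr_ge0 ?sqr_ge0.
  - by rewrite nnegrE addr_ge0 ?sqr_ge0.
  rewrite mulrDr mulr1 lerD2l mulrCA ler_piMr ?sqr_ge0//.
  by rewrite ler_pdivrMr ?mul1r// exprn_gt0.
apply: (@le_trans _ _ (iter r T (fun v => power_mean p x * 1 +
    power_mean p x * (s ^+ 2 / B ^+ 2) * v ^+ 2) 0)); last first.
  by apply: (le_iter_signavg ratio_gt0 ratio_lt1) => //; rewrite normr0 ltW.
rewrite (@iter_signavg_lin _ a r (fun=> 1) (fun v => v ^+ 2)) iter_signavg_cst.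
rewrite mulrDr lerD2l ler_peMr ?iter_signavg_sqr_ge1//.
by rewrite mulr_ge0 ?powR_ge0// divr_ge0// sqr_ge0.
Qed.

(** For p <= 2 the symmetrised power is at most (x^2 + w^2)^(p/2).  Away from 0 this
    is |x|^p up to a factor 1 + O(w^2); near 0 subadditivity only gives |x|^p + |w|^p,
    which costs 2^-r B^p on the event |u| < del. *)
Let remainder_le r u (del : R) : 1 / 2 < H -> (0 < r)%N -> 0 < del -> `|u| <= B ->
  remainder r u <=
  (1 - 2 ^- r) `^ p * (1 + 4 * B ^+ 2 / del ^+ 2 * (2 `^ (- (r%:R * H))) ^+ 2)
     * power_mean p u + 2 ^- r * B `^ p * (`|u| < del)%R%:R.
Proof.
move=> Hgt r0 d0 uB; have H0 := H_gt0; have /andP[e0 e1] := exp2Vn_itv r.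
have p2 : p <= 2 by rewrite -[leRHS]invrK lef_pV2 ?posrE ?invr_gt0//; lra.
have p1 := exponent_gt1.
have p02 : 0 < p <= 2 by lra.
have q0 : 0 < p / 2 by lra.
have q1 : 0 <= p / 2 <= 1 by lra.
have e2 : 2 ^- r <= 2^-1 :> R.
  by rewrite lef_pV2 ?posrE ?exprn_gt0// -[leLHS]expr1 ler_eXn2l// ltr1n.
rewrite remainder_sym -[leRHS](iter_signavg_cst a r _ 0).
apply: (le_iter_signavg ratio_gt0 ratio_lt1); last by rewrite normr0 ltW.
move=> v vB; set s := 2 `^ _; set x := (1 - 2 ^- r) * u.
apply: le_trans (powR_parallelogram_le _ _ p02) _.
rewrite mulrAC -onem_powR -/x.
have K0 : 0 <= 4 * B ^+ 2 / del ^+ 2 * s ^+ 2.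
  by rewrite mulr_ge0 ?sqr_ge0// divr_ge0 ?sqr_ge0// mulr_ge0// sqr_ge0.
have [ud|du] := ltP `|u| del.
  apply: (@le_trans _ _ ((x ^+ 2) `^ (p / 2) + ((s * v) ^+ 2) `^ (p / 2))).
    by apply: powR_subadd; rewrite ?sqr_ge0//; lra.
  rewrite -!normr_powR_sqr mulr1 -/(power_mean p x) lerD//.
    by rewrite ler_peMr ?powR_ge0// lerDl.
  rewrite normrM powRM// (ger0_norm (powR_ge0 _ _)) scale_powR ler_pM2l//.
  by apply: ge0_ler_powR; rewrite ?nnegrE ?(ltW Bgt0)//; lra.
rewrite mulr0 addr0.
have xd : del ^+ 2 / 4 <= x ^+ 2.
  have hd : del / 2 <= `|x|.
    rewrite normrM ger0_norm ?subr_ge0//.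
    rewrite mulrC; apply: ler_pM => //; first exact: ltW.
    by rewrite lerBrDr -lerBrDl; apply: le_trans e2 _; lra.
  rewrite -[leRHS]real_normK ?num_real//.
  have -> : del ^+ 2 / 4 = (del / 2) ^+ 2 by field.
  by rewrite ler_sqr ?nnegrE//; lra.
have x0 : 0 < x ^+ 2 by apply: lt_le_trans xd; rewrite divr_gt0// exprn_gt0.
have v2 : v ^+ 2 <= B ^+ 2.
  by rewrite -real_normK ?num_real// ler_sqr ?nnegrE ?(ltW Bgt0)//.
have key : (s * v) ^+ 2 <= x ^+ 2 * (4 * B ^+ 2 / del ^+ 2 * s ^+ 2).
  have -> : x ^+ 2 * (4 * B ^+ 2 / del ^+ 2 * s ^+ 2) =
     (s ^+ 2 * B ^+ 2) * (x ^+ 2 / (del ^+ 2 / 4)).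
    by field; rewrite !gt_eqF//; have := ratio_lt1; lra.
  rewrite exprMn; apply: (@le_trans _ _ (s ^+ 2 * B ^+ 2)).
    by rewrite ler_wpM2l ?sqr_ge0.
  apply: ler_peMr; first by apply: mulr_ge0; exact: sqr_ge0.
  rewrite ler_pdivlMr ?mul1r//.
  by rewrite divr_gt0// exprn_gt0.
apply: (@le_trans _ _ ((x ^+ 2 * (1 + 4 * B ^+ 2 / del ^+ 2 * s ^+ 2)) `^ (p / 2))).
  apply: ge0_ler_powR; first exact: ltW.
  - by rewrite nnegrE addr_ge0 ?sqr_ge0.
  - by rewrite nnegrE mulr_ge0 ?sqr_ge0// addr_ge0.
  - by rewrite mulrDr mulr1 lerD2l.
rewrite powRM ?sqr_ge0 ?addr_ge0// -normr_powR_sqr -/(power_mean p x).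
rewrite ler_wpM2l ?powR_ge0//.
apply: le_trans (powR_bernoulli_le _ q1) _; first by rewrite addr_ge0.
rewrite lerD2l addrAC subrr add0r ler_piMl//; lra.
Qed.

(** Equal to E|Z_H|^p, by [C_dyadE]. *)
Definition bernoulli_moment : R := limn (fun n => iter n T (power_mean p) 0).

Definition cell_moment (r : nat) : R := limn (fun n => iter n T (cell_mean r) 0).

Lemma cvg_bernoulli_moment :
  iter n T (power_mean p) 0 @[n --> \oo] --> bernoulli_moment.
Proof.
exact: (is_cvg_signavg ratio_gt0 ratio_lt1 power_mean_lipschitz).
Qed.

Lemma cvg_cell_moment r :
  iter n T (cell_mean r) 0 @[n --> \oo] --> cell_moment r.
Proof.
have [L hL] := cell_mean_lipschitz r.
exact: (is_cvg_signavg ratio_gt0 ratio_lt1 hL).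
Qed.

(** By convexity, averaging |.|^p over the last sign gives at least 1. *)
Lemma iter_power_mean_ge1 n : 1 <= iter n.+1 T (power_mean p) 0.
Proof.
rewrite iterSr -[leLHS](iter_signavg_cst a n 1 0).
apply: (le_iter_signavg ratio_gt0 ratio_lt1); last by rewrite normr0 ltW.
move=> u _; rewrite /signavg /power_mean.
apply: (@le_trans _ _ (((`|1 + a * u| + `|- 1 + a * u|) / 2) `^ p)); last first.
  by apply: powR_midpoint_ge => //; rewrite ltW// exponent_gt1.
have h1 : 1 <= (`|1 + a * u| + `|- 1 + a * u|) / 2.
  rewrite ler_pdivlMr// mul1r.
  have := ler_norm (1 + a * u); have := ler_norm (- (- 1 + a * u)).
  by rewrite normrN; lra.
apply: le_trans h1 (le1r_powR h1 (ltW exponent_gt1)).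
Qed.

Lemma bernoulli_moment_ge1 : 1 <= bernoulli_moment.
Proof.
apply: limr_ge; first exact: cvgP cvg_bernoulli_moment.
near=> n; have n0 : (0 < n)%N by near: n; exact: nbhs_infty_gt.
by rewrite -(prednK n0); exact: iter_power_mean_ge1.
Unshelve. all: by end_near. Qed.

Let iter_cell_mean r n : iter n T (cell_mean r) 0 =
  2 ^- r * iter (n + r) T (power_mean p) 0 + iter n T (remainder r) 0.
Proof.
rewrite (_ : cell_mean r = fun u => 2 ^- r * iter r T (power_mean p) u +
  1 * remainder r u); last by apply/funext => u; rewrite cell_meanE mul1r.
by rewrite iter_signavg_lin mul1r iterD.
Qed.

Let cell_moment_cvg r : 2 ^- r * iter (n + r) T (power_mean p) 0
  + iter n T (remainder r) 0 @[n --> \oo] --> cell_moment r.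
Proof.
rewrite (_ : (fun n => _) = fun n => iter n T (cell_mean r) 0).
  exact: cvg_cell_moment.
by apply/funext => n; rewrite iter_cell_mean.
Qed.

Let shifted_moment_cvg r :
  iter (n + r) T (power_mean p) 0 @[n --> \oo] --> bernoulli_moment.
Proof.
have := cvg_bernoulli_moment.
by rewrite -(cvg_shiftn r (fun n => iter n T (power_mean p) 0)).
Qed.

Let cell_moment_ge r : H < 1 / 2 -> (0 < r)%N ->
  (2 ^- r + (1 - 2 ^- r) `^ p * (1 + (2 `^ (- (r%:R * H))) ^+ 2 / B ^+ 2))
    * bernoulli_moment <= cell_moment r.
Proof.
move=> Hlt r0; set c := (1 - _) `^ p * _.
rewrite mulrDl.
apply: (ler_cvg_to _ (@cell_moment_cvg r)).
  apply: cvgD; apply: cvgMr; [exact: (@shifted_moment_cvg r)|exact: cvg_bernoulli_moment].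
near=> n; rewrite lerD2l.
have -> : c * iter n T (power_mean p) 0 =
    iter n T (fun u => c * power_mean p u + 0 * 0) 0.
  by rewrite (iter_signavg_lin _ _ _ (fun=> 0)) mul0r addr0.
apply: (le_iter_signavg ratio_gt0 ratio_lt1); last by rewrite normr0 ltW.
by move=> u uB; rewrite mul0r addr0; exact: remainder_ge.
Unshelve. all: by end_near. Qed.

Let cell_moment_le r N (del : R) : 1 / 2 < H -> (0 < r)%N -> (0 < N)%N -> 0 < del ->
  (forall n, (N <= n)%N -> iter n T (fun u => (`|u| < del)%R%:R) 0 * N%:R <= 2) ->
  cell_moment r <= 2 ^- r * bernoulli_moment +
    (1 - 2 ^- r) `^ p * (1 + 4 * B ^+ 2 / del ^+ 2 * (2 `^ (- (r%:R * H))) ^+ 2)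
    * bernoulli_moment + 2 ^- r * B `^ p * (2 / N%:R).
Proof.
move=> Hgt r0 N0 d0 hN; set c := (1 - _) `^ p * _.
have /andP[e0 e1] := exp2Vn_itv r.
apply: (ler_cvg_to (@cell_moment_cvg r)).
  apply: cvgD; last exact: cvg_cst.
  apply: cvgD; apply: cvgMr; [exact: (@shifted_moment_cvg r)|exact: cvg_bernoulli_moment].
near=> n => /=; rewrite -addrA lerD2l.
have Nn : (N <= n)%N by near: n; exact: nbhs_infty_ge.
apply: (@le_trans _ _ (iter n T (fun u => c * power_mean p u +
   2 ^- r * B `^ p * (`|u| < del)%R%:R) 0)).
  apply: (le_iter_signavg ratio_gt0 ratio_lt1); last by rewrite normr0 ltW.
  by move=> u uB; exact: remainder_le.
rewrite (iter_signavg_lin _ _ (power_mean p) (fun u => (`|u| < del)%R%:R)).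
rewrite lerD2l ler_wpM2l ?mulr_ge0 ?powR_ge0 ?(ltW e0)//.
by rewrite ler_pdivlMr ?ltr0n// hN.
Unshelve. all: by end_near. Qed.

Let geometric_small (rho K d : R) : 0 < rho < 1 -> 0 < d ->
  \forall r \near \oo, K * rho ^+ r < d.
Proof.
move=> /andP[rho0 rho1] d0.
have : K * rho ^+ r @[r --> \oo] --> K * 0.
  by apply: cvgMr; apply: cvg_expr; rewrite gtr0_norm.
rewrite mulr0 => /cvgr_lt; exact.
Qed.

(** Put rho = 2^(-|2H-1|) < 1.  The second order gain has size 2^(-2rH) and the loss size
    2^-r, and the smaller of the two is rho^r times the larger: gain over loss for
    H > 1/2, loss over gain for H < 1/2. *)
Lemma exists_cell_moment_neq : exists2 r : nat, (0 < r)%N &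
  (H < 1 / 2 -> bernoulli_moment < cell_moment r) /\
  (1 / 2 < H -> cell_moment r < bernoulli_moment).
Proof.
have H0 := H_gt0; have p1 := exponent_gt1; have m1 := bernoulli_moment_ge1.
have half : (2^-1 : R) = 2 `^ (-1) by rewrite powR_inv1.
have iv12 : 0 < (2^-1 : R) < 1 by apply/andP; split; lra.
have eX r : (2^-1 : R) ^+ r = 2 ^- r by rewrite exprVn.
have [Hlt|Hge] := ltP H (1 / 2).
- pose rho : R := 2 `^ (2 * H - 1).
  have rho01 : 0 < rho < 1 by rewrite powR_gt0//= powR2_lt1//; lra.
  have e_rho r : 2 ^- r = rho ^+ r * (2 `^ (- (r%:R * H))) ^+ 2 :> R.
    rewrite /rho !powR2X powR2D exp2VnE; congr (_ `^ _); ring.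
  near \oo => r; have r0 : (0 < r)%N by near: r; exact: nbhs_infty_gt.
  exists r => //; split; last by lra.
  move=> _; apply: lt_le_trans (cell_moment_ge Hlt r0).
  rewrite ltr_pMl ?(lt_le_trans _ m1)//.
  have /andP[e0 e1] := exp2Vn_itv r.
  have pe : p * 2 ^- r < 2^-1.
    by rewrite -eX; near: r; exact: geometric_small.
  have rhor : (p - 1) * B ^+ 2 * rho ^+ r < 2^-1.
    by near: r; exact: geometric_small.
  have bern : 1 - p * 2 ^- r <= (1 - 2 ^- r) `^ p.
    have := @powR_bernoulli_ge _ (1 - 2 ^- r) p.
    by rewrite addrAC subrr add0r mulrN; apply; lra.
  have B20 : 0 < B ^+ 2 by rewrite exprn_gt0.
  have s0 : 0 < (2 `^ (- (r%:R * H))) ^+ 2 :> R by rewrite exprn_gt0// powR_gt0.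
  have kE : (p - 1) * 2 ^- r < 2^-1 * ((2 `^ (- (r%:R * H))) ^+ 2 / B ^+ 2).
    rewrite mulrA ltr_pdivlMr// {1}e_rho.
    rewrite [ltLHS](_ : _ = ((p - 1) * B ^+ 2 * rho ^+ r) *
      (2 `^ (- (r%:R * H))) ^+ 2); last by ring.
    by rewrite ltr_pM2r.
  set k := _ / B ^+ 2 in kE *.
  have k0 : 0 < k by rewrite divr_gt0.
  exact: (lower_arith (p := p)).
- have [Hq|Hn] := eqVneq H (1 / 2); first by exists 1%N => //; split => ?; lra.
  have Hgt : 1 / 2 < H by rewrite lt_neqAle eq_sym Hn.
  have p2 : p < 2 by rewrite -[ltRHS]invrK ltf_pV2 ?posrE ?invr_gt0//; lra.
  have Bp0 : 0 < B `^ p by rewrite powR_gt0.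
  (* N makes 2 B^p / N, the price of the region |u| < del, less than (p - 1) / 4 *)
  pose N := (Num.truncn (8 * B `^ p / (p - 1))).+1.
  have hNN : 8 * B `^ p / (p - 1) < N%:R by exact: truncnS_gt.
  have [del d0 hdel] := signavg_anticoncentration ratio_gt0 ratio_lt1 N.
  pose rho : R := 2 `^ (1 - 2 * H).
  have rho01 : 0 < rho < 1 by rewrite powR_gt0//= powR2_lt1//; lra.
  have s_rho r : (2 `^ (- (r%:R * H))) ^+ 2 = rho ^+ r * 2 ^- r :> R.
    rewrite /rho !powR2X exp2VnE powR2D; congr (_ `^ _); ring.
  near \oo => r; have r0 : (0 < r)%N by near: r; exact: nbhs_infty_gt.
  exists r => //; split; first by move=> ?; lra.
  move=> _; apply: le_lt_trans (cell_moment_le Hgt r0 (ltn0Sn _) d0 hdel) _.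
  have /andP[e0 e1] := exp2Vn_itv r.
  have e2 : 1 * 2 ^- r < 2^-1 :> R.
    by rewrite -eX; near: r; exact: geometric_small.
  have rhor : 4 * B ^+ 2 / del ^+ 2 * rho ^+ r < (p - 1) / 2.
    by near: r; apply: geometric_small => //; lra.
  rewrite mul1r in e2.
  have bern : (1 - 2 ^- r) `^ p <= (1 - 2 ^- r) * (1 - (p - 1) * 2 ^- r).
    have y0 : 0 <= 1 - 2 ^- r :> R by lra.
    rewrite -mulr_powRB1 ?(lt_trans ltr01)// ler_wpM2l//.
    have q01 : 0 <= p - 1 <= 1 by lra.
    by have := powR_bernoulli_le y0 q01; lra.
  have hN2 : B `^ p * (2 / N%:R) < (p - 1) / 4.
    have N0 : 0 < N%:R :> R by rewrite ltr0n.
    rewrite mulrA ltr_pdivrMr//.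
    by have := hNN; rewrite ltr_pdivrMr; lra.
  have k0 : 0 <= 4 * B ^+ 2 / del ^+ 2 * rho ^+ r.
    apply: mulr_ge0; last by rewrite exprn_ge0// powR_ge0.
    by rewrite divr_ge0 ?sqr_ge0// mulr_ge0// sqr_ge0.
  rewrite s_rho [_ * (rho ^+ r * _)]mulrA -[_ * _ * (2 / _)]mulrA.
  by apply: (upper_arith (p := p)) => //; apply/andP.
Unshelve. all: by end_near. Qed.

End CellMean.

(** * Increments of the bridge *)

Section Tent.
Context {R : realType}.
Implicit Types (u v h : R).

Lemma tent_le0 u : u <= 0 -> schauder00 u = 0.
Proof. by move=> u0; rewrite /schauder00 minEle maxEle; case: ifP; case: ifP; lra. Qed.

Lemma tent_ge1 u : 1 <= u -> schauder00 u = 0.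
Proof. by move=> u0; rewrite /schauder00 minEle maxEle; case: ifP; case: ifP; lra. Qed.

Lemma tent_left u : 0 <= u -> u <= 1 / 2 -> schauder00 u = u.
Proof. by move=> u0 u1; rewrite /schauder00 minEle maxEle; case: ifP; case: ifP; lra. Qed.

Lemma tent_right u : 1 / 2 <= u -> u <= 1 -> schauder00 u = 1 - u.
Proof. by move=> u0 u1; rewrite /schauder00 minEle maxEle; case: ifP; case: ifP; lra. Qed.

Lemma tent_int (i k : nat) : schauder00 (i%:R - k%:R : R) = 0.
Proof.
have [ik|ki] := leqP i k.
  by rewrite tent_le0// subr_le0 ler_nat.
by rewrite tent_ge1// lerBrDl natr1 ler_nat.
Qed.

Lemma tent_half_int (i k : nat) :
  schauder00 (i%:R + 2^-1 - k%:R : R) = (i == k)%:R / 2.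
Proof.
have [ki|ik|->] := ltngtP k i.
- rewrite mul0r tent_ge1//; have : k%:R + 1 <= i%:R :> R by rewrite natr1 ler_nat.
  lra.
- rewrite mul0r tent_le0//; have : i%:R + 1 <= k%:R :> R by rewrite natr1 ler_nat.
  lra.
- by rewrite tent_left /= ?mulr1n; lra.
Qed.

(** The breakpoints j, j + 1/2, j + 1 of a tent lie on the grid of mesh 2^-(q+1), so
    the tent is affine between consecutive grid points. *)
Lemma tent_midpoint (q k j : nat) :
  schauder00 (k%:R * 2 ^- q.+1 + 2 ^- q.+1 / 2 - j%:R : R) =
  (schauder00 (k%:R * 2 ^- q.+1 - j%:R) +
   schauder00 (k.+1%:R * 2 ^- q.+1 - j%:R)) / 2.
Proof.
set h : R := 2 ^- q.+1.
have h0 : 0 < h by rewrite invr_gt0 exprn_gt0.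
have hM : (2 ^ q)%:R * h = 2^-1.
  by rewrite /h natrX exprS invfM mulrCA divff ?mulr1// expf_neq0.
rewrite -[k.+1%:R]natr1 (mulrDl k%:R 1) mul1r; set x := k%:R * h.
have toR (m n : nat) : (m <= n)%N -> m%:R * h <= n%:R * h.
  by move=> mn; rewrite ler_pM2r// ler_nat.
have E c : (j * 2 ^ q.+1 + c * 2 ^ q)%:R * h = j%:R + c%:R / 2.
  rewrite expnS natrD !natrM mulrDl -!mulrA hM; lra.
have E1 : k.+1%:R * h = x + h by rewrite -[k.+1%:R]natr1 mulrDl mul1r.
(* the four affine pieces: left of the support, rising, falling, right of it *)
have [c1|/toR] := ltnP k (j * 2 ^ q.+1 + 0 * 2 ^ q).
  by have := toR _ _ c1; rewrite E E1 => ?; rewrite !tent_le0; lra.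
rewrite E => c1; have [c2|/toR] := ltnP k (j * 2 ^ q.+1 + 1 * 2 ^ q).
  have := toR _ _ c2; rewrite E E1 -/x in c1 * => ?.
  by rewrite !tent_left; lra.
rewrite E => c2; have [c3|/toR] := ltnP k (j * 2 ^ q.+1 + 2 * 2 ^ q).
  have := toR _ _ c3; rewrite E E1 -/x in c1 c2 * => ?.
  by rewrite !tent_right; lra.
rewrite E -/x in c1 c2 * => ?.
by rewrite !tent_ge1; lra.
Qed.

End Tent.

Section Bridge.
Context {R : realType}.
Variables (H : R) (s : nat -> nat -> R).
Local Notation a := (2 `^ (H - 1) : R).

Definition bridge_level (n : nat) (t : R) : R :=
  2 `^ (- (n%:R * H)) * \sum_(k < 2 ^ n) s n k * schauder00 (2 ^+ n * t - k%:R).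

Definition bridge (t : R) : R := limn (series (bridge_level ^~ t)).

(** The sign of level m is added on left halves and subtracted on right halves;
    earlier levels are damped by a. *)
Fixpoint slope (n k : nat) : R :=
  if n is m.+1 then (-1) ^+ odd k * s m k./2 + a * slope m k./2 else 0.

Lemma bridge_level_grid n N j : (N <= n)%N -> bridge_level n (j%:R * 2 ^- N) = 0.
Proof.
move=> Nn; rewrite /bridge_level big1 ?mulr0// => k _.
have -> : 2 ^+ n * (j%:R * 2 ^- N) = (j * 2 ^ (n - N))%:R :> R.
  rewrite natrM natrX -{1}(subnK Nn) exprD.
  by rewrite mulrCA mulfK// expf_neq0.
by rewrite tent_int mulr0.
Qed.

Lemma bridge_grid N j :
  bridge (j%:R * 2 ^- N) = \sum_(n < N) bridge_level n (j%:R * 2 ^- N).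
Proof.
apply: lim_near_cst => //; near=> n.
have Nn : (N <= n)%N by near: n; exact: nbhs_infty_ge.
rewrite /series /= -(big_mkord xpredT (bridge_level ^~ (j%:R * 2 ^- N))).
rewrite (big_cat_nat _ Nn)//= [X in _ + X]big1_seq ?addr0// => m /=.
by rewrite mem_index_iota => /andP[Nm _]; rewrite bridge_level_grid.
Unshelve. all: by end_near. Qed.

Lemma bridge_level_midpoint n N j : (n < N)%N ->
  bridge_level n (j.*2.+1%:R * 2 ^- N.+1) =
  (bridge_level n (j%:R * 2 ^- N) + bridge_level n (j.+1%:R * 2 ^- N)) / 2.
Proof.
move=> nN; rewrite /bridge_level -mulrDr -mulrA; congr (_ * _).
rewrite -big_split mulr_suml; apply: eq_bigr => k _ /=.
rewrite -mulrDr -mulrA; congr (_ * _).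
have [q Nq] : exists q, N = (n + q.+1)%N.
  by exists (N - n).-1; rewrite prednK ?subn_gt0// subnKC// ltnW.
have e i : 2 ^+ n * (i * 2 ^- N) = i * 2 ^- q.+1 :> R.
  by rewrite Nq exprD invfM mulrCA mulVKf ?expf_neq0.
rewrite !e -tent_midpoint; congr (schauder00 (_ - _)).
rewrite -addnn -addn1 !natrD exprS invfM.
rewrite (_ : 2 ^+ n * _ = 2 ^+ n * (j%:R * 2 ^- N) + 2 ^+ n * (1 * 2 ^- N) / 2).
  by rewrite !e mul1r.
by field; rewrite expf_neq0.
Qed.

Lemma bridge_level_new N j : (j < 2 ^ N)%N ->
  bridge_level N (j.*2.+1%:R * 2 ^- N.+1) = 2 `^ (- (N%:R * H)) * s N j / 2.
Proof.
move=> jN; rewrite /bridge_level -mulrA; congr (_ * _).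
have -> : 2 ^+ N * (j.*2.+1%:R * 2 ^- N.+1) = j%:R + 2^-1 :> R.
  rewrite -addnn -addn1 !natrD exprS invfM; field.
  by rewrite expf_neq0.
rewrite (bigD1 (Ordinal jN))//= big1 => [|k kj].
  by rewrite tent_half_int eqxx mul1r addr0.
rewrite tent_half_int eq_sym; move: kj; rewrite -val_eqE /= => /negbTE ->.
by rewrite mul0r mulr0.
Qed.

Lemma bridge_double N j : bridge (j.*2%:R * 2 ^- N.+1) = bridge (j%:R * 2 ^- N).
Proof.
congr bridge; rewrite -addnn natrD exprS invfM; field.
by rewrite expf_neq0.
Qed.

Lemma bridge_midpoint N j : (j < 2 ^ N)%N ->
  bridge (j.*2.+1%:R * 2 ^- N.+1) =
  (bridge (j%:R * 2 ^- N) + bridge (j.+1%:R * 2 ^- N)) / 2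
  + 2 `^ (- (N%:R * H)) * s N j / 2.
Proof.
move=> jN; rewrite !bridge_grid big_ord_recr /= bridge_level_new//; congr (_ + _).
rewrite -big_split /= mulr_suml; apply: eq_bigr => n _.
exact: bridge_level_midpoint.
Qed.

(** Passing to the two halves of an interval halves its increment and adds or
    subtracts half the new height; self-similarity of the scaling gives the
    recursion of the slopes. *)
Lemma bridge_increment N k : (k < 2 ^ N)%N ->
  bridge (k.+1%:R * 2 ^- N) - bridge (k%:R * 2 ^- N) =
  2 `^ (- (N%:R * H)) * a * slope N k.
Proof.
elim: N k => [|N IH] k.
  rewrite expn0 ltnS leqn0 => /eqP ->.
  by rewrite !bridge_grid !big_ord0 subrr mulr0.
rewrite expnS mul2n => kN.
have jN : (k./2 < 2 ^ N)%N by rewrite ltn_half_double.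
have aa : 2 `^ (- (N.+1%:R * H)) * a = 2 `^ (- (N%:R * H)) / 2 :> R.
  rewrite -(powR_inv1 (ler0n _ 2)) -!powRD ?pnatr_eq0 ?implybT//.
  by congr (_ `^ _); rewrite -natr1; ring.
have := IH _ jN; rewrite aa /=.
set j := k./2 in jN *; set c := 2 `^ _ => inc.
have [ko|ke] := boolP (odd k).
  have kE : k = j.*2.+1 by rewrite -(odd_double_half k) ko.
  rewrite kE -doubleS bridge_double bridge_midpoint// expr1 -/c; lra.
have kE : k = j.*2 by rewrite -[LHS](odd_double_half k) (negbTE ke).
rewrite kE bridge_double bridge_midpoint// expr0 -/c; lra.
Qed.

End Bridge.

(** * Partitions and variation sums *)

Lemma sum_pairs {V : nmodType} (F : nat -> V) m :
  \sum_(i < m.*2) F i = \sum_(k < m) (F k.*2 + F k.*2.+1).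
Proof.
elim: m => [|m IH]; first by rewrite !big_ord0.
by rewrite doubleS 2!big_ord_recr IH /= [RHS]big_ord_recr /= addrA.
Qed.

Lemma mem_iota0S i n : (i \in iota 0 n.+1) = (i <= n)%N.
Proof. by rewrite mem_iota add0n ltnS. Qed.

Lemma half_doubleS k : (k.*2.+1)./2 = k. Proof. exact: uphalf_double. Qed.

Lemma odd_doubleS k : odd k.*2.+1. Proof. by rewrite /= odd_double. Qed.

Section Partitions.
Context {R : realType}.

Lemma fset_sort_eq (tau : {fset R}) (f : nat -> R) M :
  (forall i, (i < M)%N -> f i < f i.+1) ->
  (forall x, (x \in tau) = (x \in [seq f i | i <- iota 0 M.+1])) ->
  sort <=%R (enum_fset tau) = [seq f i | i <- iota 0 M.+1].
Proof.
move=> fS tauE.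
have srt : sorted <%R [seq f i | i <- iota 0 M.+1].
  apply/(sortedP 0) => i; rewrite size_map size_iota => iM.
  rewrite !(nth_map 0%N) ?size_iota//; last exact: ltnW.
  by rewrite !nth_iota// ?add0n; [exact: fS|exact: ltnW].
apply: (sorted_eq le_trans le_anti (sort_sorted le_total _)).
  by apply: sub_sorted srt => x y /ltW.
rewrite perm_sort; apply: uniq_perm; [exact: fset_uniq| |exact: tauE].
exact: (sorted_uniq lt_trans (fun x => ltxx x) srt).
Qed.

Lemma card_pt (tau : {fset R}) (f : nat -> R) M :
  (forall i, (i < M)%N -> f i < f i.+1) ->
  (forall x, (x \in tau) = (x \in [seq f i | i <- iota 0 M.+1])) ->
  #|` tau| = M.+1 /\ forall i, (i <= M)%N -> pt tau i = f i.
Proof.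
move=> fS tauE; have sE := fset_sort_eq fS tauE; split.
  by rewrite -(size_sort <=%R) sE size_map size_iota.
move=> i iM; rewrite /pt sE (nth_map 0%N) ?size_iota// nth_iota//.
Qed.

Lemma terminal_pvar_sum p (x : R -> R) (tau : {fset R}) (f : nat -> R) M :
  (forall i, (i < M)%N -> f i < f i.+1) ->
  (forall t, (t \in tau) = (t \in [seq f i | i <- iota 0 M.+1])) ->
  (forall i, (i <= M)%N -> f i <= 1) ->
  terminal_pvar p x tau = \sum_(i < M) `|x (f i.+1) - x (f i)| `^ p.
Proof.
move=> fS tauE f1; have [cE ptE] := card_pt fS tauE.
rewrite /terminal_pvar /pvar cE /=; apply: eq_bigr => i _.
by rewrite !ptE ?(ltnW (ltn_ord i))// !min_l ?f1// ltnW.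
Qed.

Lemma mesh_le (tau : {fset R}) (f : nat -> R) M c : 0 <= c ->
  (forall i, (i < M)%N -> f i < f i.+1) ->
  (forall t, (t \in tau) = (t \in [seq f i | i <- iota 0 M.+1])) ->
  (forall i, (i < M)%N -> f i.+1 - f i <= c) -> mesh tau <= c.
Proof.
move=> c0 fS tauE fc; have [cE ptE] := card_pt fS tauE.
rewrite /mesh cE /=; apply/bigmax_leP; split => // i _.
by rewrite !ptE ?(ltnW (ltn_ord i))// fc.
Qed.

Lemma mesh_ge0 (tau : {fset R}) : 0 <= mesh tau.
Proof. exact: bigmax_ge_id. Qed.

(** Increasing enumeration of the shifted grid: even indices are dyadic points, odd
    ones the extra points. *)
Definition shifted_point (r n i : nat) : R :=
  2 ^- n * ((i./2)%:R + (odd i)%:R * 2 ^- r).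

Lemma mem_dyadic_grid n (t : R) : (t \in dyadic_grid n) =
  (t \in [seq i%:R * 2 ^- n | i <- iota 0 (2 ^ n).+1]).
Proof.
apply/imfsetP/mapP => [[k _ ->]|[k]].
  exists (k : nat); last by [].
  by rewrite mem_iota0S -ltnS ltn_ord.
by rewrite mem_iota0S => kn ->; exists (Ordinal (kn : (k < (2 ^ n).+1)%N)).
Qed.

Lemma mem_shifted_grid r n (t : R) : (t \in shifted_grid r n) =
  (t \in [seq shifted_point r n i | i <- iota 0 (2 ^ n).*2.+1]).
Proof.
apply/idP/idP.
  rewrite in_fsetU mem_dyadic_grid => /orP[/mapP[k]|/imfsetP[k _ ->]].
    rewrite mem_iota0S => kn ->; apply/mapP; exists k.*2.
      by rewrite mem_iota0S leq_double.
    by rewrite /shifted_point doubleK odd_double mul0r addr0 mulrC.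
  apply/mapP; exists (k : nat).*2.+1.
    by rewrite mem_iota0S ltn_double ltn_ord.
  by rewrite /shifted_point half_doubleS odd_doubleS mul1r.
move=> /mapP[i]; rewrite mem_iota0S => iM ->.
rewrite in_fsetU mem_dyadic_grid; apply/orP.
have [io|ie] := boolP (odd i).
  right; have iE : i = i./2.*2.+1 by rewrite -[LHS]odd_double_half io.
  have ih : (i./2 < 2 ^ n)%N by move: iM; rewrite {1}iE ltn_double.
  apply/imfsetP; exists (Ordinal ih) => //=.
  by rewrite /shifted_point io mul1r.
left; apply/mapP; exists i./2.
  rewrite mem_iota0S -leq_double.
  by apply: leq_trans iM; rewrite -[leqRHS]odd_double_half (negbTE ie).
by rewrite /shifted_point (negbTE ie) mul0r addr0 mulrC.
Qed.

Lemma dyadic_point_lt n i : i%:R * 2 ^- n < i.+1%:R * 2 ^- n :> R.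
Proof. by rewrite ltr_pM2r ?ltr_nat// invr_gt0 exprn_gt0. Qed.

Lemma dyadic_point_le1 n i : (i <= 2 ^ n)%N -> i%:R * 2 ^- n <= 1 :> R.
Proof. by move=> h; rewrite ler_pdivrMr ?exprn_gt0// mul1r -natrX ler_nat. Qed.

Lemma exp2Vn_lt1 r : (0 < r)%N -> 2 ^- r < 1 :> R.
Proof. by move=> r0; rewrite invf_lt1 ?exprn_gt0// exprn_egt1 ?ltr1n// -lt0n. Qed.

Lemma shifted_point_step r n i : (0 < r)%N ->
  shifted_point r n i < shifted_point r n i.+1 <= shifted_point r n i + 2 ^- n.
Proof.
move=> r0; rewrite /shifted_point.
have e1 := exp2Vn_lt1 r0; have e0 : 0 < 2 ^- r :> R by rewrite invr_gt0 exprn_gt0.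
have n0 : 0 < 2 ^- n :> R by rewrite invr_gt0 exprn_gt0.
have step (x y : R) : x < y <= x + 1 ->
    2 ^- n * x < 2 ^- n * y <= 2 ^- n * x + 2 ^- n.
  move=> /andP[xy y1]; rewrite ltr_pM2l// xy /=.
  by rewrite -[X in _ + X]mulr1 -mulrDr ler_pM2l.
apply: step; have [k [->|->]] : exists k, i = k.*2 \/ i = k.*2.+1.
  exists i./2; case: (boolP (odd i)) => io; [right|left];
    by rewrite -[LHS]odd_double_half ?io ?(negbTE io).
- by rewrite half_doubleS odd_doubleS doubleK odd_double mul1r mul0r; lra.
- rewrite half_doubleS odd_doubleS -doubleS doubleK odd_double mul1r mul0r.
  by rewrite -[k.+1%:R]natr1; lra.
Qed.

Lemma shifted_point_le1 r n i : (0 < r)%N -> (i <= (2 ^ n).*2)%N ->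
  shifted_point r n i <= 1.
Proof.
move=> r0; rewrite leq_eqVlt => /predU1P[->|iM].
  by rewrite /shifted_point doubleK odd_double mul0r addr0 natrX mulVf// expf_neq0.
have ih : (i./2 < 2 ^ n)%N by rewrite ltn_half_double.
rewrite /shifted_point mulrC ler_pdivrMr ?exprn_gt0// mul1r.
apply: (@le_trans _ _ (i./2.+1%:R)); last by rewrite -natrX ler_nat.
have e1 := exp2Vn_lt1 r0; have e0 : 0 < 2 ^- r :> R by rewrite invr_gt0 exprn_gt0.
by rewrite -[_.+1%:R]natr1; case: (odd i); rewrite ?mul1r ?mul0r; lra.
Qed.

Lemma shifted_point_lt r n i : (0 < r)%N ->
  shifted_point r n i < shifted_point r n i.+1.
Proof. by move=> r0; case/andP: (shifted_point_step n i r0). Qed.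

Lemma mesh_dyadic_grid n : mesh (dyadic_grid n : {fset R}) <= 2 ^- n.
Proof.
apply: (mesh_le _ _ (mem_dyadic_grid n)).
- by rewrite invr_ge0 exprn_ge0.
- by move=> i _; exact: dyadic_point_lt.
- by move=> i _; rewrite -mulrBl -natr1 addrAC subrr add0r mul1r.
Qed.

Lemma mesh_shifted_grid r n : (0 < r)%N ->
  mesh (shifted_grid r n : {fset R}) <= 2 ^- n.
Proof.
move=> r0; apply: (mesh_le _ _ (mem_shifted_grid r n)).
- by rewrite invr_ge0 exprn_ge0.
- by move=> i _; exact: shifted_point_lt.
- by move=> i _; rewrite lerBlDl; case/andP: (shifted_point_step n i r0).
Qed.

Lemma is_partition_dyadic_grid n : is_partition (dyadic_grid n : {fset R}).
Proof.
split.
- rewrite mem_dyadic_grid; apply/mapP; exists 0%N; rewrite ?mul0r//.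
- rewrite mem_dyadic_grid; apply/mapP; exists (2 ^ n)%N.
    by rewrite mem_iota0S.
  by rewrite natrX divff// expf_neq0.
- move=> t; rewrite mem_dyadic_grid => /mapP[i]; rewrite mem_iota0S.
  by move=> iM ->; rewrite divr_ge0 ?exprn_ge0//= dyadic_point_le1.
Qed.

Lemma dyadic_sub_shifted r n :
  (dyadic_grid n `<=` (shifted_grid r n : {fset R}))%fset.
Proof. exact: fsubsetUl. Qed.

Lemma shifted_sub_dyadic r n :
  (shifted_grid r n `<=` (dyadic_grid (n + r) : {fset R}))%fset.
Proof.
apply/fsubsetP => t; rewrite mem_shifted_grid mem_dyadic_grid.
move=> /mapP[i]; rewrite mem_iota0S => iM ->.
have ih : (i./2 * 2 ^ r + odd i <= 2 ^ (n + r))%N.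
  rewrite expnD; move: iM; rewrite leq_eqVlt => /predU1P[->|iM].
    by rewrite doubleK odd_double addn0.
  have ih : (i./2 < 2 ^ n)%N by rewrite ltn_half_double.
  apply: (@leq_trans (i./2.+1 * 2 ^ r)); last by rewrite leq_mul2r ih orbT.
  by rewrite mulSn addnC leq_add2r; case: (odd i) => //; rewrite expn_gt0.
apply/mapP; exists (i./2 * 2 ^ r + odd i)%N; first by rewrite mem_iota0S.
rewrite /shifted_point natrD natrM natrX exprD; field.
by rewrite !expf_neq0.
Qed.

Lemma is_partition_shifted_grid r n : is_partition (shifted_grid r n : {fset R}).
Proof.
have [h0 h1 _] := is_partition_dyadic_grid n.
have [_ _ h] := is_partition_dyadic_grid (n + r).
split; [exact: (fsubsetP (dyadic_sub_shifted r n))..|].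
by move=> t /(fsubsetP (shifted_sub_dyadic r n)); exact: h.
Qed.

End Partitions.

Section BridgeVariation.
Context {R : realType}.
Variables (H : R) (s : nat -> nat -> R).
Hypothesis H01 : 0 < H < 1.
Local Notation p := H^-1.
Local Notation a := (2 `^ (H - 1) : R).

Lemma ratio_powR : a `^ p = 2 `^ (1 - p).
Proof.
rewrite -powRrM; congr (_ `^ _).
by rewrite mulrBl mulfV ?mul1r// gt_eqF//; case/andP: H01.
Qed.

Lemma increment_powR N (u : R) :
  `|2 `^ (- (N%:R * H)) * a * u| `^ p = 2 `^ (1 - p) * 2 ^- N * power_mean p u.
Proof.
rewrite !normrM !(ger0_norm (powR_ge0 _ _)) powRM ?mulr_ge0 ?powR_ge0//.
by rewrite powRM ?powR_ge0// scale_powR// ratio_powR [2 ^- N * _]mulrC.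
Qed.

Lemma pvar_dyadic_grid n : terminal_pvar p (bridge H s) (dyadic_grid n) =
  2 `^ (1 - p) * (2 ^- n * \sum_(k < 2 ^ n) power_mean p (slope H s n k)).
Proof.
rewrite (terminal_pvar_sum _ _ _ (mem_dyadic_grid n)); last 2 first.
- by move=> i _; exact: dyadic_point_lt.
- by move=> i; exact: dyadic_point_le1.
rewrite mulrA mulr_sumr; apply: eq_bigr => k _.
by rewrite bridge_increment// increment_powR.
Qed.

(** The left piece of the cell k is the dyadic interval of level n + r with index
    k 2^r, and the right piece is the rest of the dyadic interval of level n. *)
Lemma pvar_shifted_grid r n : (0 < r)%N ->
  terminal_pvar p (bridge H s) (shifted_grid r n) =
  2 `^ (1 - p) * (2 ^- n *
    \sum_(k < 2 ^ n) cell H r (slope H s n k) (slope H s (n + r) (k * 2 ^ r))).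
Proof.
move=> r0; rewrite (terminal_pvar_sum _ _ _ (mem_shifted_grid r n)); last 2 first.
- by move=> i _; exact: shifted_point_lt.
- by move=> i; exact: shifted_point_le1.
rewrite (sum_pairs (fun i => `|bridge H s (shifted_point r n i.+1) -
  bridge H s (shifted_point r n i)| `^ p)).
rewrite mulrA mulr_sumr; apply: eq_bigr => k _.
have e0 : shifted_point r n k.*2 = k%:R * 2 ^- n :> R.
  by rewrite /shifted_point doubleK odd_double mul0r addr0 mulrC.
have e0' : shifted_point r n k.*2 = (k * 2 ^ r)%:R * 2 ^- (n + r) :> R.
  by rewrite e0 natrM natrX exprD; field; rewrite !expf_neq0.
have e1 : shifted_point r n k.*2.+1 = (k * 2 ^ r).+1%:R * 2 ^- (n + r) :> R.
  rewrite /shifted_point half_doubleS odd_doubleS -[_.+1%:R in RHS]natr1 natrM natrX exprD mul1r.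
  by field; rewrite !expf_neq0.
have e2 : shifted_point r n k.*2.+2 = k.+1%:R * 2 ^- n :> R.
  by rewrite /shifted_point -doubleS doubleK odd_double mul0r addr0 mulrC.
have kr : (k * 2 ^ r < 2 ^ (n + r))%N.
  by rewrite expnD ltn_mul2r expn_gt0 ltn_ord.
have left_ := bridge_increment H s kr.
have full := bridge_increment H s (ltn_ord k).
have cE : 2 `^ (- ((n + r)%:R * H)) = 2 `^ (- (n%:R * H)) * 2 `^ (- (r%:R * H)) :> R.
  by rewrite powR2D natrD; congr (_ `^ _); ring.
have right_ : bridge H s (shifted_point r n k.*2.+2) -
    bridge H s (shifted_point r n k.*2.+1) =
    2 `^ (- (n%:R * H)) * a * (slope H s n k -
       2 `^ (- (r%:R * H)) * slope H s (n + r) (k * 2 ^ r)).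
  rewrite mulrBr -full mulrA -[_ * a * _]mulrA [a * _]mulrC mulrA -cE -left_.
  rewrite -e0' -e1 -e0 -e2; ring.
rewrite right_ e1 e0' left_ !increment_powR /cell exprD invfM; ring.
Qed.

Hypothesis s_sign : forall n k, (k < 2 ^ n)%N -> s n k = 1 \/ s n k = -1.

(** The two children of an interval receive opposite signs, so both branches of the
    averaging operator occur once, whatever the sign is. *)
Lemma slope_mean n (f : R -> R) :
  2 ^- n * \sum_(k < 2 ^ n) f (slope H s n k) = iter n (signavg a) f 0.
Proof.
elim: n f => [|n IH] f; first by rewrite expr0 invr1 mul1r big_ord1.
rewrite iterSr -IH expnS mul2n (sum_pairs (fun k => f (slope H s n.+1 k))).
rewrite exprS invfM [2^-1 * _]mulrC -mulrA mulr_sumr; congr (_ * _).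
apply: eq_bigr => k _; rewrite /signavg /= ?half_doubleS ?uphalf_double doubleK odd_double.
by case: (s_sign (ltn_ord k)) => ->; rewrite expr1 expr0 ?mul1r ?mulN1r ?opprK; lra.
Qed.

Lemma slope_bound n k : (k < 2 ^ n)%N -> `|slope H s n k| <= (1 - a)^-1.
Proof.
have a0 := @ratio_gt0 R H; have a1 := ratio_lt1 H01.
elim: n k => [|n IH] k; first by rewrite normr0 ltW// signs_bound_gt0.
rewrite expnS mul2n => kN /=.
have jN : (k./2 < 2 ^ n)%N by rewrite ltn_half_double.
have [h1 h2] := signs_bound_stable a0 a1 (IH _ jN).
by case: (odd k); case: (s_sign jN) => ->;
  rewrite ?expr1 ?expr0 ?mul1r ?mulN1r ?opprK.
Qed.

End BridgeVariation.

(** * Coin tossing and the variance of the shifted sums *)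

Section CoinTossing.
Context {R : realType}.
Implicit Types (b : nat -> bool).

Definition sign_of (x : bool) : R := if x then 1 else -1.

Definition extend N (beta : {ffun 'I_N -> bool}) : nat -> bool :=
  fun i => oapp beta false (insub i).

(** Uniform expectation over N coin tosses, as a plain finite sum: linearity and
    flips of coordinates then come without measurability conditions. *)
Definition coin_mean N (F : (nat -> bool) -> R) : R :=
  2 ^- N * \sum_(beta : {ffun 'I_N -> bool}) F (extend beta).

Definition flip (i : nat) b : nat -> bool := fun j => (j == i) (+) b j.

Lemma sign_ofN x : sign_of (~~ x) = - sign_of x.
Proof. by case: x; rewrite /sign_of ?opprK. Qed.

Lemma coin_mean_sum N (I : Type) (t : seq I) (F : I -> (nat -> bool) -> R) :
  coin_mean N (fun b => \sum_(i <- t) F i b) = \sum_(i <- t) coin_mean N (F i).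
Proof. by rewrite /coin_mean exchange_big /= mulr_sumr. Qed.

Lemma coin_meanZ N c F : coin_mean N (fun b => c * F b) = c * coin_mean N F.
Proof. by rewrite /coin_mean -mulr_sumr mulrCA. Qed.

Lemma coin_mean_cst N c : coin_mean N (fun=> c) = c.
Proof.
rewrite /coin_mean sumr_const card_ffun card_bool card_ord.
by rewrite -[c *+ _]mulr_natl natrX mulrA mulVf ?mul1r// expf_neq0.
Qed.

Lemma le_coin_mean N F G :
  (forall b, F b <= G b) -> coin_mean N F <= coin_mean N G.
Proof.
move=> FG; rewrite ler_wpM2l ?invr_ge0 ?exprn_ge0//.
by apply: ler_sum => beta _; exact: FG.
Qed.

Lemma coin_mean_flip N i F : (i < N)%N ->
  coin_mean N (fun b => F (flip i b)) = coin_mean N F.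
Proof.
move=> iN; rewrite /coin_mean; congr (_ * _).
pose ff (beta : {ffun 'I_N -> bool}) := [ffun j : 'I_N => (j == i :> nat) (+) beta j].
have ffK : involutive ff.
  by move=> beta; apply/ffunP => j; rewrite !ffunE addbA addbb.
rewrite [RHS](reindex_inj (inv_inj ffK)); apply: eq_bigr => beta _; congr F.
apply/funext => j; rewrite /flip /extend.
case: insubP => [j' _ <-|] /=; first by rewrite ffunE.
by rewrite -leqNgt => Nj; rewrite addbF gtn_eqF// (leq_trans iN).
Qed.

(** Integrating out a coin that enters nowhere else applies the averaging operator:
    pair each configuration with the one where coin i is flipped. *)
Lemma coin_mean_resample N i (a : R) (F : (nat -> bool) -> R -> R)
    (V : (nat -> bool) -> R) : (i < N)%N ->
  (forall b, F (flip i b) = F b) -> (forall b, V (flip i b) = V b) ->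
  coin_mean N (fun b => F b (sign_of (b i) + a * V b)) =
  coin_mean N (fun b => signavg a (F b) (V b)).
Proof.
move=> iN Fi Vi.
set G := fun b => _; set K := fun b => signavg a (F b) (V b).
have KE b : K b = 2^-1 * G b + 2^-1 * G (flip i b).
  rewrite /K /G Fi Vi /flip eqxx addTb sign_ofN /signavg.
  by case: (b i); rewrite /sign_of ?opprK; lra.
have -> : coin_mean N K = 2^-1 * coin_mean N G + 2^-1 * coin_mean N (fun b => G (flip i b)).
  rewrite -!coin_meanZ /coin_mean -mulrDr -big_split /=.
  by congr (_ * _); apply: eq_bigr => beta _; exact: KE.
rewrite coin_mean_flip//; lra.
Qed.

(** Partial sum of Z_H, in Horner form so that its first coin can be integrated out. *)
Fixpoint discounted_sum (a : R) (b : nat -> bool) (j n : nat) : R :=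
  if n is m.+1 then sign_of (b j) + a * discounted_sum a b j.+1 m else 0.

Lemma discounted_sumE a b j n :
  discounted_sum a b j n = \sum_(m < n) a ^+ m * sign_of (b (j + m)%N).
Proof.
elim: n j => [|n IH] j /=; first by rewrite big_ord0.
rewrite big_ord_recl expr0 mul1r addn0 IH mulr_sumr; congr (_ + _).
by apply: eq_bigr => m _; rewrite mulrA -exprS addSnnS.
Qed.

Lemma discounted_sum_flip a b i j n : (i < j)%N ->
  discounted_sum a (flip i b) j n = discounted_sum a b j n.
Proof.
move=> ij; rewrite !discounted_sumE; apply: eq_bigr => m _.
by rewrite /flip gtn_eqF// (leq_trans ij)// leq_addr.
Qed.

Lemma coin_mean_discounted_sum N a j n (f : R -> R) : (j + n <= N)%N ->
  coin_mean N (fun b => f (discounted_sum a b j n)) = iter n (signavg a) f 0.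
Proof.
elim: n j f => [|n IH] j f jN; first exact: (coin_mean_cst N (f 0)).
rewrite iterSr -(IH j.+1) ?addSnnS//=.
rewrite (@coin_mean_resample _ j a (fun=> f) (fun b => discounted_sum a b j.+1 n)) //.
  by apply: leq_trans jN; rewrite addnS ltnS leq_addr.
by move=> b; rewrite discounted_sum_flip.
Qed.

End CoinTossing.

(** Breadth-first numbering of the binary tree, from 0: it turns the signs into a
    single sequence in which the levels below n occupy the indices below 2^n - 1. *)
Definition node (n k : nat) : nat := (2 ^ n + k).-1.

Lemma nodeS n k : (node n k).+1 = (2 ^ n + k)%N.
Proof. by rewrite /node prednK// addn_gt0 expn_gt0. Qed.

Lemma trunc_log_node n k : (k < 2 ^ n)%N -> trunc_log 2 (node n k).+1 = n.
Proof.
move=> kn; apply: trunc_log_eq => //.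
by rewrite nodeS leq_addr/= expnS mul2n -addnn ltn_add2l.
Qed.

Lemma node_inj n k m j : (k < 2 ^ n)%N -> (j < 2 ^ m)%N ->
  node n k = node m j -> n = m /\ k = j.
Proof.
move=> kn jm e; have nm : n = m.
  by rewrite -(trunc_log_node kn) e trunc_log_node.
split=> //; apply/eqP; rewrite -(eqn_add2l (2 ^ n)) -nodeS e nodeS nm //.
Qed.

Lemma node_lt n k N : (k < 2 ^ n)%N -> (n < N)%N -> (node n k < 2 ^ N)%N.
Proof.
move=> kn nN; rewrite nodeS -ltnS; apply: ltnW; rewrite ltnS.
apply: (@leq_trans (2 ^ n.+1)); last by rewrite leq_exp2l.
by rewrite expnS mul2n -addnn -addnS leq_add2l.
Qed.

Section TreeVariance.
Context {R : realType}.
Variable H : R.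
Hypothesis H01 : 0 < H < 1.
Local Notation p := H^-1.
Local Notation a := (2 `^ (H - 1) : R).
Local Notation B := (1 - a)^-1.

Definition coin_field (b : nat -> bool) (n k : nat) : R := sign_of (b (node n k)).

Local Notation U b := (slope H (coin_field b)).

Lemma coin_field_sign b n k : coin_field b n k = 1 \/ coin_field b n k = -1.
Proof. by rewrite /coin_field /sign_of; case: (b _); [left|right]. Qed.

Lemma eq_slope b b' n k : (k < 2 ^ n)%N ->
  (forall m j, (m < n)%N -> (j < 2 ^ m)%N -> b (node m j) = b' (node m j)) ->
  U b n k = U b' n k.
Proof.
elim: n k => // n IH k; rewrite expnS mul2n => kn bb' /=.
have hn : (k./2 < 2 ^ n)%N by rewrite ltn_half_double.
rewrite IH// => [|m j mn jm]; last by rewrite bb'// ltnS ltnW.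
by rewrite /coin_field bb'.
Qed.

Lemma slope_flip b i n k : (k < 2 ^ n)%N ->
  (forall m j, (m < n)%N -> (j < 2 ^ m)%N -> node m j != i) ->
  U (flip i b) n k = U b n k.
Proof.
move=> kn hi; apply: eq_slope => // m j mn jm.
by rewrite /flip (negbTE (hi _ _ mn jm)).
Qed.

Lemma slope_flip_deep b m j n k : (k < 2 ^ n)%N -> (j < 2 ^ m)%N -> (n <= m)%N ->
  U (flip (node m j) b) n k = U b n k.
Proof.
move=> kn jm nm; apply: slope_flip => // m' j' m'n j'm'.
apply/eqP => /(node_inj j'm' jm)[mm _].
by move: m'n; rewrite mm ltnNge nm.
Qed.

Lemma slope_leftmost b n k r : U b (n + r.+1) (k * 2 ^ r.+1) =
  coin_field b (n + r) (k * 2 ^ r) + a * U b (n + r) (k * 2 ^ r).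
Proof.
rewrite addnS /= expnS mulnCA mul2n odd_double expr0 mul1r.
by rewrite doubleK.
Qed.

Lemma ltn_leftmost n k r : (k < 2 ^ n)%N -> (k * 2 ^ r < 2 ^ (n + r))%N.
Proof. by move=> kn; rewrite expnD ltn_mul2r expn_gt0. Qed.

(** The left edges below two different cells have no node in common. *)
Lemma slope_leftmost_flip b n k k' r i : (k < 2 ^ n)%N -> (k' < 2 ^ n)%N ->
  k' != k ->
  U (flip (node (n + i) (k * 2 ^ i)) b) (n + r) (k' * 2 ^ r) =
  U b (n + r) (k' * 2 ^ r).
Proof.
move=> kn k'n kk'; elim: r => [|r IH].
  rewrite addn0 expn0 muln1 slope_flip_deep ?leq_addr//; exact: ltn_leftmost.
rewrite !slope_leftmost IH; congr (_ + _).
rewrite /coin_field /flip; case: eqP => // e; exfalso.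
have [/addnI ri] := node_inj (ltn_leftmost r k'n) (ltn_leftmost i kn) e.
rewrite ri => /eqP; rewrite eqn_pmul2r ?expn_gt0// => /eqP kE.
by rewrite kE eqxx in kk'.
Qed.

(** The r coins on the left edge below the cell are integrated out one after the
    other, the deepest first. *)
Lemma coin_mean_leftmost N n k r (F : (nat -> bool) -> R -> R) :
  (k < 2 ^ n)%N -> (2 ^ (n + r) <= N)%N ->
  (forall i b, (i < r)%N -> F (flip (node (n + i) (k * 2 ^ i)) b) = F b) ->
  coin_mean N (fun b => F b (U b (n + r) (k * 2 ^ r))) =
  coin_mean N (fun b => iter r (signavg a) (F b) (U b n k)).
Proof.
move=> kn; elim: r F => [|r IH] F rN Fi.
  by rewrite addn0 expn0 muln1.
transitivity (coin_mean N (fun b => signavg a (F b) (U b (n + r) (k * 2 ^ r)))).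
  rewrite -(@coin_mean_resample _ _ (node (n + r) (k * 2 ^ r))).
  - by congr coin_mean; apply/funext => b; rewrite slope_leftmost.
  - by apply: leq_trans rN; apply: node_lt; [exact: ltn_leftmost|rewrite addnS].
  - by move=> b; exact: Fi.
  - by move=> b; rewrite slope_flip_deep//; exact: ltn_leftmost.
rewrite (IH (fun b => signavg a (F b))).
- by congr coin_mean; apply/funext => b; rewrite iterSr.
- by apply: leq_trans rN; rewrite leq_exp2l// leq_add2l.
- by move=> i b ir; rewrite Fi// ltnW.
Qed.

Definition cell_average (r n : nat) (b : nat -> bool) : R :=
  2 ^- n * \sum_(k < 2 ^ n) cell H r (U b n k) (U b (n + r) (k * 2 ^ r)).

Definition cell_mean_average (r n : nat) : R :=
  iter n (signavg a) (cell_mean H r) 0.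

Let deviation r n (k : nat) b : R :=
  cell H r (U b n k) (U b (n + r) (k * 2 ^ r)) - cell_mean H r (U b n k).

(** The deviation of the cell k' does not see the coins on the left edge below k, and
    integrating these out of the deviation of k gives zero. *)
Let deviation_orth N r n k k' : (k < 2 ^ n)%N -> (k' < 2 ^ n)%N -> k' != k ->
  (2 ^ (n + r) <= N)%N ->
  coin_mean N (fun b => deviation r n k' b * deviation r n k b) = 0.
Proof.
move=> kn k'n kk' nN.
have Ui i b : U (flip (node (n + i) (k * 2 ^ i)) b) n k = U b n k.
  by rewrite slope_flip_deep ?leq_addr//; exact: ltn_leftmost.
have U'i i b : U (flip (node (n + i) (k * 2 ^ i)) b) n k' = U b n k'.
  by rewrite slope_flip_deep ?leq_addr//; exact: ltn_leftmost.
pose F b v := deviation r n k' b * (cell H r (U b n k) v - cell_mean H r (U b n k)).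
rewrite -[LHS]/(coin_mean N (fun b => F b (U b (n + r) (k * 2 ^ r)))).
rewrite coin_mean_leftmost//.
  rewrite -[RHS](coin_mean_cst N 0); congr coin_mean; apply/funext => b.
  rewrite (_ : F b = fun v => deviation r n k' b * cell H r (U b n k) v +
     (- (deviation r n k' b * cell_mean H r (U b n k))) * 1); last first.
    by apply/funext => v; rewrite /F mulr1 mulrBr.
  rewrite (iter_signavg_lin _ _ _ (fun=> 1)) iter_signavg_cst mulr1.
  by rewrite -/(cell_mean H r (U b n k)) subrr.
move=> i b ir; apply/funext => v; rewrite /F Ui; congr (_ * _).
by rewrite /deviation U'i slope_leftmost_flip.
Qed.

Let deviation_le r : exists2 M : R, 0 <= M & forall n k b, (k < 2 ^ n)%N ->
  `|deviation r n k b| <= M.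
Proof.
have a0 := @ratio_gt0 R H; have a1 := ratio_lt1 H01.
have B0 := signs_bound_gt0 a1.
have p0 : 0 <= p by rewrite invr_ge0; case/andP: H01 => /ltW.
pose M := 2 * (2 * B) `^ p.
have pm x : `|x| <= 2 * B -> power_mean p x <= (2 * B) `^ p.
  by move=> xB; apply: ge0_ler_powR => //; rewrite nnegrE mulr_ge0// ltW.
have cellM u v : `|u| <= B -> `|v| <= B -> 0 <= cell H r u v <= M.
  move=> uB vB; have /andP[e0 e1] := @exp2Vn_itv R r.
  have v1 : 2 ^- r * power_mean p v <= (2 * B) `^ p.
    apply: le_trans (pm v _); last by apply: le_trans vB _; lra.
    by rewrite ler_piMl// powR_ge0.
  have v2 : power_mean p (u - 2 `^ (- (r%:R * H)) * v) <= (2 * B) `^ p.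
    apply: pm; apply: le_trans (ler_normB _ _) _.
    rewrite normrM (ger0_norm (powR_ge0 _ _)).
    have : 2 `^ (- (r%:R * H)) * `|v| <= `|v| by rewrite ler_piMl// scale_le1.
    lra.
  rewrite addr_ge0 ?powR_ge0//=; last by rewrite mulr_ge0 ?powR_ge0// ltW.
  by rewrite /cell /M; lra.
have cmM u : `|u| <= B -> 0 <= cell_mean H r u <= M.
  move=> uB; apply/andP; split.
    rewrite -[leLHS](iter_signavg_cst a r 0 u); apply: (le_iter_signavg a0 a1) => // v vB.
    by case/andP: (cellM _ _ uB vB).
  rewrite -[leRHS](iter_signavg_cst a r M u); apply: (le_iter_signavg a0 a1) => // v vB.
  by case/andP: (cellM _ _ uB vB).
exists M; first by rewrite mulr_ge0 ?powR_ge0.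
move=> n k b kn; rewrite /deviation.
have sgn m j : (j < 2 ^ m)%N -> coin_field b m j = 1 \/ coin_field b m j = -1.
  by move=> _; exact: coin_field_sign.
have uB := slope_bound H01 sgn kn.
have vB := slope_bound H01 sgn (ltn_leftmost r kn).
have /andP[? ?] := cellM _ _ uB vB; have /andP[? ?] := cmM _ uB.
by rewrite ler_norml; apply/andP; split; lra.
Qed.

(** Expanding the square, only the 2^n diagonal terms out of 4^n survive. *)
Lemma cell_average_variance r : exists2 M : R, 0 <= M & forall n,
  coin_mean (2 ^ (n + r)) (fun b => (cell_average r n b - cell_mean_average r n) ^+ 2)
  <= M * 2 ^- n.
Proof.
have [M M0 hM] := deviation_le r; exists (M ^+ 2); first exact: sqr_ge0.
move=> n; set N := (2 ^ (n + r))%N.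
have sgn b m j : (j < 2 ^ m)%N -> coin_field b m j = 1 \/ coin_field b m j = -1.
  by move=> _; exact: coin_field_sign.
have dE b : (cell_average r n b - cell_mean_average r n) ^+ 2 =
    2 ^- n ^+ 2 * \sum_(k' < 2 ^ n) \sum_(k < 2 ^ n) deviation r n k' b * deviation r n k b.
  rewrite /cell_mean_average -(@slope_mean _ _ _ (sgn b)) /cell_average -mulrBr -sumrB.
  rewrite exprMn; congr (_ * _); rewrite expr2 mulr_suml.
  by apply: eq_bigr => k' _; rewrite mulr_sumr.
rewrite (_ : (fun b => _) = (fun b => 2 ^- n ^+ 2 * \sum_(k' < 2 ^ n)
  \sum_(k < 2 ^ n) deviation r n k' b * deviation r n k b)); last exact/funext.
rewrite coin_meanZ coin_mean_sum.
apply: (@le_trans _ _ (2 ^- n ^+ 2 * \sum_(k' < 2 ^ n) M ^+ 2)).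
  rewrite ler_wpM2l ?sqr_ge0//; apply: ler_sum => k' _.
  rewrite coin_mean_sum (bigD1 k')//= big1 ?addr0 => [|k kk']; last first.
    by apply: deviation_orth => //; rewrite eq_sym.
  rewrite -[leRHS](coin_mean_cst N); apply: le_coin_mean => b.
  by rewrite -expr2 -real_normK ?num_real// ler_sqr ?nnegrE ?hM.
rewrite sumr_const card_ord -[M ^+ 2 *+ _]mulr_natl natrX.
rewrite le_eqVlt; apply/orP; left; apply/eqP; field.
by rewrite expf_neq0.
Qed.

Lemma eq_cell_average r n b b' :
  (forall i, (i < 2 ^ (n + r))%N -> b i = b' i) ->
  cell_average r n b = cell_average r n b'.
Proof.
move=> bb'; rewrite /cell_average; congr (_ * _); apply: eq_bigr => k _.
by congr cell; apply: eq_slope => [|m j mn jm]; rewrite ?ltn_leftmost//;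
  apply: bb'; apply: node_lt => //; exact: leq_trans mn (leq_addr _ _).
Qed.

End TreeVariance.

(** * From finite coin tossing to probability spaces *)

Section Integrals.
Import HBNNSimple.
Context {R : realType} {d : measure_display} {T : measurableType d}.
Variable P : {measure set T -> \bar R}.

(** A simple function below f, set to zero on the null set, is a simple function
    below g with the same integral.  This covers integrands that are not measurable,
    such as functions of a random series that may diverge on a null set. *)
Lemma le_integral_off_null (N : set T) (f g : T -> \bar R) :
  measurable N -> P N = 0 ->
  (forall w, (0 <= f w)%E) -> (forall w, (0 <= g w)%E) ->
  (forall w, ~ N w -> (f w <= g w)%E) ->
  (\int[P]_w f w <= \int[P]_w g w)%E.
Proof.
move=> mN PN f0 g0 fg.
rewrite ge0_integralE//; apply: ge_ereal_sup => _ [h hf <-].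
rewrite patch_setT in hf.
pose k := proj_nnsfun h (measurableC mN).
have kE : (\int[P]_w (h w)%:E = \int[P]_w (k w)%:E)%E.
  apply: ae_eq_integral => //.
  - exact/measurable_EFinP.
  - exact/measurable_EFinP.
  exists N; split => // w /= /not_implyP[_ hk]; apply: contrapT => Nw; apply: hk.
  by rewrite /k mindicE mem_set// mulr1.
rewrite -integralT_nnsfun kE integralT_nnsfun ge0_integralE//.
apply: ereal_sup_ubound; exists k => // w.
rewrite patch_setT /k /= mindicE.
have [/set_mem Nw|/negP Nw] := boolP (w \in ~` N).
  by rewrite mulr1; exact: le_trans (hf w) (fg _ Nw).
by rewrite mulr0.
Qed.

(** The sum of the series has a finite integral, so it is finite almost everywhere
    and its terms tend to 0. *)
Lemma ae_cvg0_of_summable_integral (u : nat -> T -> R) (c : R) :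
  (forall n, measurable_fun setT (u n)) -> (forall n w, 0 <= u n w) ->
  (forall n, (\int[P]_w (u n w)%:E <= (c * 2 ^- n)%:E)%E) ->
  {ae P, forall w, u n w @[n --> \oo] --> (0 : R)}.
Proof.
move=> mu u0 uc.
have mEu n : measurable_fun setT (EFin \o u n) by exact/measurable_EFinP.
have sum_fin : (\int[P]_w (\sum_(0 <= n <oo) (u n w)%:E) < +oo)%E.
  rewrite integral_nneseries//; last by move=> n w _; rewrite lee_fin.
  apply: (@le_lt_trans _ _ (\sum_(0 <= n <oo) (c * 2 ^- n)%:E)%E).
    apply: lee_nneseries => [n _ _|n _]; last exact: uc.
    by apply: integral_ge0 => w _; rewrite lee_fin.
  have h : series (geometric c (2^-1)) n @[n --> \oo] --> c / (1 - 2^-1).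
    by apply: cvg_geometric_series; rewrite ger0_norm; lra.
  rewrite (_ : (fun n => _) = EFin \o series (geometric c 2^-1)).
    by rewrite EFin_lim ?ltry//; exact: cvgP h.
  apply/funext => n /=; rewrite /series /= sumEFin; congr EFin.
  by apply: eq_bigr => i _; rewrite /geometric /= exprVn.
have intS : P.-integrable setT (fun w => (\sum_(0 <= n <oo) (u n w)%:E)%E).
  apply/integrableP; split.
    apply: (@ge0_emeasurable_sum _ _ _ _ (fun n w => (u n w)%:E) xpredT) => //.
      by move=> k w _ _; rewrite lee_fin.
    by move=> k _; exact: mEu.
  rewrite (eq_integral (fun w => (\sum_(0 <= n <oo) (u n w)%:E)%E))//.
  by move=> w _; rewrite gee0_abs// nneseries_ge0// => n _ _; rewrite lee_fin.
apply: filterS (integrable_ae measurableT intS) => w /(_ I) finS.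
apply: cvg_series_cvg_0; apply: nondecreasing_is_cvgn.
  by apply/nondecreasing_seqP => n; rewrite /series /= big_nat_recr//= lerDl.
exists (fine (\sum_(0 <= n <oo) (u n w)%:E)%E) => _ [n _ <-].
rewrite -lee_fin fineK//; rewrite /series /= -sumEFin.
by apply: nneseries_lim_ge => k _ _; rewrite lee_fin.
Qed.

End Integrals.

Section CoinsLink.
Context {R : realType} {d : measure_display} {T : measurableType d}.
Variables (P : probability T R) (Y : nat -> {RV P >-> R}).
Hypothesis radY : rademacher_family Y.

(** A genuine coin sequence everywhere, equal to the signs outside a null set. *)
Definition coins (w : T) (i : nat) : bool := Y i w == 1.

Let cylinder N (beta : {ffun 'I_N -> bool}) : set T :=
  [set w | forall i : 'I_N, coins w i = beta i].

Let side (x : bool) : set R := if x then [set 1] else ~` [set 1].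

Let measurable_side x : measurable (side x).
Proof. by case: x => /=; [|apply: measurableC]. Qed.

Let Yside i x : Y i @^-1` side x = [set w | coins w i = x].
Proof.
apply/seteqP; split => w; rewrite /side /coins; case: x => /=.
- by move=> ->; rewrite eqxx.
- by move=> /eqP/negbTE.
- by move=> /eqP.
- by move=> h /eqP; rewrite h.
Qed.

Let prob_side i x : P (Y i @^-1` side x) = (2^-1)%:E.
Proof.
have [h1 _] := radY.2 i; case: x => //.
rewrite (_ : Y i @^-1` side false = ~` (Y i @^-1` [set 1]))//.
rewrite probability_setC; last first.
  by rewrite -[X in measurable X]setTI; exact: measurable_funPT.
by rewrite h1 -EFinB; congr EFin; lra.
Qed.

Let cylinderE N (beta : {ffun 'I_N -> bool}) : cylinder beta =
  \bigcap_(i in [set` [fset i in iota 0 N]%fset]) (Y i @^-1` side (extend beta i)).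
Proof.
apply/seteqP; split => w /=.
  move=> h i /=; rewrite inE /= mem_iota add0n => /= iN.
  suff: (Y i @^-1` side (extend beta i)) w by [].
  rewrite Yside /= /extend insubT /=; exact: (h (Ordinal iN)).
move=> h i; have : (Y i @^-1` side (extend beta i)) w.
  by apply: h; rewrite /= inE /= mem_iota add0n ltn_ord.
by rewrite Yside /= => ->; rewrite /extend valK.
Qed.

Let measurable_cylinder N (beta : {ffun 'I_N -> bool}) : measurable (cylinder beta).
Proof.
rewrite cylinderE; apply: fin_bigcap_measurable => // i _.
by rewrite -[X in measurable X]setTI; exact: measurable_funPT.
Qed.

Let prob_cylinder N (beta : {ffun 'I_N -> bool}) : P (cylinder beta) = (2 ^- N)%:E.
Proof.
rewrite cylinderE radY.1//.
under eq_bigr do rewrite prob_side.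
rewrite prodEFin big_const_seq count_predT; congr EFin.
have -> : size [fset i in iota 0 N]%fset = N.
  by rewrite card_fseq undup_id ?iota_uniq// size_iota.
by rewrite -exprVn; elim: N {beta} => //= n ->; rewrite exprS.
Qed.

Definition first_coins_only N (F : (nat -> bool) -> R) : Prop :=
  forall b b', (forall i, (i < N)%N -> b i = b' i) -> F b = F b'.

Let first_coins_indic N F w : first_coins_only N F ->
  F (coins w) = \sum_(beta : {ffun 'I_N -> bool}) F (extend beta) * \1_(cylinder beta) w.
Proof.
move=> lF; pose b0 := [ffun i : 'I_N => coins w i].
rewrite (bigD1 b0)//= big1 => [|beta bb0].
  rewrite addr0 indicE mem_set ?mulr1; last by move=> i; rewrite ffunE.
  by apply: lF => i iN; rewrite /extend insubT /= ffunE.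
rewrite indicE memNset ?mulr0// => h; move/eqP: bb0; apply.
by apply/ffunP => i; rewrite ffunE h.
Qed.

Lemma measurable_first_coins N F :
  first_coins_only N F -> measurable_fun setT (fun w => F (coins w)).
Proof.
move=> lF; under eq_fun do rewrite (first_coins_indic _ lF).
by apply: measurable_sum => beta; exact: measurable_funM.
Qed.

(** The functional is a finite combination of indicators of cylinders, each of
    probability 2^-N by independence. *)
Lemma integral_first_coins N F : first_coins_only N F -> (forall b, 0 <= F b) ->
  (\int[P]_w (F (coins w))%:E = (coin_mean N F)%:E)%E.
Proof.
move=> lF F0.
under eq_integral do rewrite (first_coins_indic _ lF) -sumEFin.
rewrite ge0_integral_sum//; last 2 first.
- by move=> beta; apply/measurable_EFinP; exact: measurable_funM.
- by move=> beta w _; rewrite lee_fin mulr_ge0.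
rewrite /coin_mean mulr_sumr -sumEFin; apply: eq_bigr => beta _.
under eq_integral do rewrite EFinM.
rewrite ge0_integralZl_EFin//; last by apply/measurable_EFinP; exact: measurable_indic.
by rewrite integral_indic// setIT [X in (_ * X)%E](prob_cylinder beta) -EFinM mulrC.
Qed.

Lemma ae_sign_of_coins : {ae P, forall w, forall i, Y i w = sign_of (coins w i)}.
Proof.
apply: ae_foralln => i.
have [h1 h2] := radY.2 i.
have mY A : measurable A -> measurable (Y i @^-1` A).
  by move=> mA; rewrite -[X in measurable X]setTI; exact: measurable_funPT.
have tot : P (Y i @^-1` [set 1] `|` Y i @^-1` [set -1]) = 1%E.
  rewrite measureU; [|exact: mY|exact: mY|].
    by rewrite [X in (X + _)%E]h1 [X in (_ + X)%E]h2 -EFinD; congr EFin; lra.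
  by apply/seteqP; split => // w /= [-> ]; lra.
have mU : measurable (Y i @^-1` [set 1] `|` Y i @^-1` [set -1]).
  by apply: measurableU; exact: mY.
exists (~` (Y i @^-1` [set 1] `|` Y i @^-1` [set -1])); split.
- exact: measurableC.
- by have := probability_setC P mU; rewrite tot subee.
move=> w /= hw; apply: contra_not hw => -[hw|hw].
  by rewrite /coins hw eqxx.
by rewrite /coins hw; case: eqP => //; lra.
Qed.

End CoinsLink.

(** * The dyadic constant and the signs of the tree *)

Section DyadicConstant.
Context {R : realType}.
Variable H : R.
Hypothesis H01 : 0 < H < 1.
Local Notation p := H^-1.
Local Notation a := (2 `^ (H - 1) : R).
Local Notation B := (1 - a)^-1.

Let a0 : 0 < a := ratio_gt0 H.
Let a1 : a < 1 := ratio_lt1 H01.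

Lemma discounted_sum_bound (b : nat -> bool) j n : `|discounted_sum a b j n| <= B.
Proof.
elim: n j => [|n IH] j; first by rewrite normr0 ltW// signs_bound_gt0.
have [h1 h2] := signs_bound_stable a0 a1 (IH j.+1).
by rewrite /=; case: (b j).
Qed.

Lemma discounted_sum_cat (b : nat -> bool) j n m : discounted_sum a b j (n + m) =
  discounted_sum a b j n + a ^+ n * discounted_sum a b (j + n) m.
Proof.
elim: n j => [|n IH] j /=; first by rewrite add0n addn0 expr0 mul1r add0r.
by rewrite IH addSnnS exprS; ring.
Qed.

Lemma cvg_discounted_sum (b : nat -> bool) :
  cvgn (fun n => discounted_sum a b 0 n).
Proof.
rewrite (_ : (fun n => _) = series (fun m => a ^+ m * sign_of (b m))).
  apply: normed_cvg; apply: (@series_le_cvg _ _ (geometric 1 a)) => //.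
  - by move=> n /=.
  - by move=> n; rewrite /geometric /= mul1r exprn_ge0// ltW.
  - move=> n; rewrite /geometric /= normrM normrX gtr0_norm// mul1r.
    by rewrite /sign_of; case: (b n); rewrite ?normrN normr1 mulr1.
  - by apply: is_cvg_geometric_series; rewrite gtr0_norm.
by apply/funext => n; rewrite discounted_sumE /series /= big_mkord.
Qed.

(** The remainder after n terms is a^n times a signed sum. *)
Lemma discounted_sum_tail (b : nat -> bool) n :
  `|limn (fun m => discounted_sum a b 0 m) - discounted_sum a b 0 n| <= a ^+ n * B.
Proof.
have lim_tail : discounted_sum a b 0 (n + m) - discounted_sum a b 0 n @[m --> \oo]
    --> limn (fun m => discounted_sum a b 0 m) - discounted_sum a b 0 n.
  apply: cvgB; last exact: cvg_cst.
  rewrite (_ : (fun m => _) = (fun m => discounted_sum a b 0 (m + n))).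
    have := @cvg_discounted_sum b.
    by rewrite -(cvg_shiftn n (fun m => discounted_sum a b 0 m)).
  by apply/funext => m; rewrite addnC.
rewrite -(cvg_lim _ (cvg_norm lim_tail))//; apply: limr_le.
  exact: cvgP (cvg_norm lim_tail).
apply: nearW => m; rewrite discounted_sum_cat addrAC subrr add0r normrM normrX.
by rewrite (gtr0_norm a0) ler_pM2l ?exprn_gt0// discounted_sum_bound.
Qed.

Lemma lim_discounted_sum_bound (b : nat -> bool) :
  `|limn (fun m => discounted_sum a b 0 m)| <= B.
Proof.
by have := discounted_sum_tail b 0; rewrite expr0 mul1r /= subr0.
Qed.

Context {d : measure_display} {T : measurableType d}.
Variables (P : probability T R) (Y : nat -> {RV P >-> R}).
Hypothesis radY : rademacher_family Y.

Let dyad_series_coins w : (forall i, Y i w = sign_of (coins Y w i)) ->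
  dyad_series H Y w = limn (fun m => discounted_sum a (coins Y w) 0 m).
Proof.
move=> Yw; rewrite /dyad_series; congr (lim (_ @ \oo)); apply/funext => n.
rewrite discounted_sumE /series /= big_mkord; apply: eq_bigr => m _.
by rewrite add0n -Yw powR2X mulrC [_ * (H - 1)]mulrC mulrC.
Qed.

(** The expectation of |Z_H|^p is squeezed, outside the null set where the signs are
    not +-1, between the finite means of |Z_n|^p -+ c a^n; the lower bound is cut
    at 0 in order to compare nonnegative functions only. *)
Lemma C_dyadE : C_dyad H Y = 2 `^ (1 - p) * bernoulli_moment H.
Proof.
have [N [mN PN goodN]] := ae_sign_of_coins radY.
have good w : ~ N w -> forall i, Y i w = sign_of (coins Y w i).
  by move=> Nw; apply: contrapT => h; apply: Nw; apply: goodN.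
pose Z n (b : nat -> bool) := power_mean p (discounted_sum a b 0 n).
pose c := p * (2 * B) `^ (p - 1) * B.
have B0 : 0 < B := signs_bound_gt0 a1.
have p0 : 0 <= p by rewrite invr_ge0; case/andP: H01 => /ltW.
have c0 : 0 <= c by rewrite /c !mulr_ge0 ?powR_ge0// ltW.
have close n w : ~ N w ->
    `|power_mean p (dyad_series H Y w) - Z n (coins Y w)| <= c * a ^+ n.
  move=> /good Yw; rewrite (dyad_series_coins Yw).
  apply: le_trans (power_mean_lipschitz H01 (lim_discounted_sum_bound _)
    (discounted_sum_bound _ _ _)) _.
  rewrite /c -[leRHS]mulrA [B * _]mulrC.
  by rewrite ler_wpM2l ?discounted_sum_tail// mulr_ge0 ?powR_ge0.
have locZ n : first_coins_only n (Z n).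
  move=> b b' bb'; rewrite /Z !discounted_sumE; congr power_mean.
  by apply: eq_bigr => m _; rewrite add0n bb'.
have mean_Z n : coin_mean n (Z n) = iter n (signavg a) (power_mean p) 0.
  by rewrite /Z (coin_mean_discounted_sum a (power_mean p) (leqnn n : (0 + n <= n)%N)).
set E := (\int[P]_w (`|dyad_series H Y w| `^ p)%:E)%E.
have cn0 n : 0 <= c * a ^+ n by rewrite mulr_ge0// exprn_ge0// ltW.
have up n : (E <= (iter n (signavg a) (power_mean p) 0 + c * a ^+ n)%:E)%E.
  have -> : iter n (signavg a) (power_mean p) 0 + c * a ^+ n =
      coin_mean n (fun b => Z n b + c * a ^+ n).
    rewrite -mean_Z -[X in _ + X](coin_mean_cst n) /coin_mean -mulrDr -big_split.
    by [].
  rewrite -(integral_first_coins radY); last 2 first.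
  - by move=> b b' bb'; rewrite (locZ n b b').
  - by move=> b; rewrite addr_ge0// powR_ge0.
  apply: (le_integral_off_null mN PN) => w; rewrite ?lee_fin.
  - exact: powR_ge0.
  - by rewrite addr_ge0// powR_ge0.
  move=> /(close n); rewrite -/(power_mean p _) ler_norml => /andP[_].
  by rewrite lerBlDl.
have low n : ((iter n (signavg a) (power_mean p) 0 - c * a ^+ n)%:E <= E)%E.
  apply: (@le_trans _ _ (coin_mean n (fun b => Num.max 0 (Z n b - c * a ^+ n)))%:E).
    rewrite lee_fin.
    have -> : iter n (signavg a) (power_mean p) 0 - c * a ^+ n =
        coin_mean n (fun b => Z n b - c * a ^+ n).
      rewrite -mean_Z -[X in _ - X](coin_mean_cst n) /coin_mean -mulrBr -sumrB.
      by [].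
    by apply: le_coin_mean => b; rewrite le_max lexx orbT.
  rewrite -(integral_first_coins radY); last 2 first.
  - by move=> b b' bb'; rewrite (locZ n b b').
  - by move=> b; rewrite le_max lexx.
  apply: (le_integral_off_null mN PN) => w; rewrite ?lee_fin.
  - by rewrite le_max lexx.
  - exact: powR_ge0.
  move=> /(close n); rewrite -/(power_mean p _) distrC ler_norml => /andP[_].
  by rewrite ge_max powR_ge0 /= lerBlDl lerBlDr addrC.
have Efin : E \is a fin_num.
  by rewrite fin_numE -ltNye -ltey (lt_le_trans _ (low 0%N)) ?ltNyr// (le_lt_trans (up 0%N))// ltry.
rewrite /C_dyad unlock -/E; congr (_ * _).
apply/eqP; rewrite eq_le; apply/andP.
have lim_c : c * a ^+ n @[n --> \oo] --> (0 : R).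
  by rewrite -(mulr0 c); apply: cvgMr; apply: cvg_expr; rewrite gtr0_norm.
have lims := cvg_bernoulli_moment H01.
split.
  have h : iter n (signavg a) (power_mean p) 0 + c * a ^+ n @[n --> \oo]
      --> bernoulli_moment H.
    by rewrite -[X in _ --> X]addr0; exact: cvgD lims lim_c.
  rewrite -(cvg_lim _ h)//; apply: limr_ge; first exact: cvgP h.
  by apply: nearW => n /=; rewrite -lee_fin fineK.
have h : iter n (signavg a) (power_mean p) 0 - c * a ^+ n @[n --> \oo]
    --> bernoulli_moment H.
  by rewrite -[X in _ --> X]subr0; exact: cvgB lims lim_c.
rewrite -(cvg_lim _ h)//; apply: limr_le; first exact: cvgP h.
by apply: nearW => n /=; rewrite -lee_fin fineK.
Qed.

End DyadicConstant.

Section TreeSigns.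
Context {R : realType} {d : measure_display} {T : measurableType d}.
Variables (P : probability T R) (theta : forall n : nat, 'I_(2 ^ n) -> {RV P >-> R}).
Local Notation tree := {n : nat & 'I_(2 ^ n)}.

Let level_of (i : nat) := trunc_log 2 i.+1.

Let pos_lt i : (i.+1 - 2 ^ level_of i < 2 ^ level_of i)%N.
Proof.
have /andP[h1 h2] := @trunc_log_bounds 2 i.+1 isT isT.
by rewrite ltn_subLR// addnn -mul2n -expnS.
Qed.

Definition tree_node (i : nat) : tree := existT _ (level_of i) (Ordinal (pos_lt i)).

Definition node_index (x : tree) : nat := node (tag x) (tagged x).

Lemma tree_nodeK : cancel tree_node node_index.
Proof.
move=> i; have /andP[h1 _] := @trunc_log_bounds 2 i.+1 isT isT.
by rewrite /node_index /tree_node /= /node subnKC.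
Qed.

Lemma node_index_inj : injective node_index.
Proof.
move=> [n k] [m j]; rewrite /node_index /= => e.
have [nm kj] := node_inj (ltn_ord k) (ltn_ord j) e.
by move: j {e} kj; rewrite -nm => j kj; congr existT; exact: val_inj.
Qed.

Lemma node_indexK : cancel node_index tree_node.
Proof. by move=> x; apply: node_index_inj; rewrite tree_nodeK. Qed.

Definition heap_signs (i : nat) : {RV P >-> R} :=
  @theta (tag (tree_node i)) (tagged (tree_node i)).

Lemma heap_signsE n (k : 'I_(2 ^ n)) : @theta n k = heap_signs (node n k).
Proof.
by rewrite /heap_signs -/(node_index (existT _ n k)) node_indexK.
Qed.

Hypothesis rad_theta : rademacher_signs theta.

(** Independence over finite sets of indices is transported along the bijection
    between integers and nodes of the tree. *)
Lemma rademacher_heap_signs : rademacher_family heap_signs.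
Proof.
have [ind rad] := rad_theta; split; last by move=> i; exact: rad (tree_node i).
move=> J A mA.
have tinj : {in J &, injective tree_node} by move=> x y _ _; exact: (can_inj tree_nodeK).
have := ind [fset tree_node i | i in J]%fset (fun x => A (node_index x))
  (fun x => mA (node_index x)).
rewrite big_imfset//=.
rewrite (_ : [set` [fset tree_node i | i in J]%fset] = tree_node @` [set` J]).
  rewrite bigcap_image.
  under eq_bigcapr do rewrite tree_nodeK.
  by under [in RHS]eq_bigr do rewrite tree_nodeK.
apply/seteqP; split => x /=.
  by move=> /imfsetP[i /= iJ ->]; exists i.
by move=> [i iJ <-]; apply/imfsetP; exists i.
Qed.

Lemma takagi_bridgeE (H : R) w :
  (forall i, heap_signs i w = sign_of (coins heap_signs w i)) ->
  takagi_bridge H theta w = bridge H (coin_field (coins heap_signs w)).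
Proof.
move=> hw; apply/funext => t; rewrite /takagi_bridge /bridge.
congr (lim (series _ @ \oo)); apply/funext => n; rewrite /bridge_level.
rewrite !mulr_sumr; apply: eq_bigr => k _.
rewrite heap_signsE hw /schauder -/(coin_field _ _ _).
rewrite (_ : - (n%:R * H) = n%:R * (1 / 2 - H) + - (n%:R / 2)); last by field.
by rewrite -powR2D; ring.
Qed.

End TreeSigns.

(** * The oscillating sequence of partitions *)

Lemma cvg_infty_of_ge (f : nat -> nat) :
  (forall n, (n <= 2 * f n + 1)%N) -> f @ \oo --> \oo.
Proof.
move=> hf; apply/cvgnyPge => A; near=> n.
have : (2 * A + 1 <= n)%N by near: n; exact: nbhs_infty_ge.
by have := hf n; lia.
Unshelve. all: by end_near. Qed.

Section OscillatingGrids.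
Context {R : realType}.

(** For n = 2j - 1 the half of n rounded up is j; for n = 2j the integer n./2 + 1 is j + 1. *)
Definition oscillating_grids (r n : nat) : {fset R} :=
  if odd n then shifted_grid r (uphalf n * r) else dyadic_grid (n./2.+1 * r).

Lemma oscillating_grids_odd r j : (1 <= j)%N ->
  oscillating_grids r (2 * j - 1) = shifted_grid r (j * r).
Proof.
case: j => // j _; rewrite mul2n doubleS subn1 /= /oscillating_grids.
by rewrite odd_doubleS -[uphalf _]/(j.*2.+2)./2 -doubleS doubleK.
Qed.

Lemma oscillating_grids_even r j :
  oscillating_grids r (2 * j) = dyadic_grid (j.+1 * r).
Proof. by rewrite mul2n /oscillating_grids odd_double doubleK. Qed.

Lemma is_partition_oscillating_grids r n : is_partition (oscillating_grids r n).
Proof.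
rewrite /oscillating_grids; case: (odd n).
  exact: is_partition_shifted_grid.
exact: is_partition_dyadic_grid.
Qed.

Lemma refining_oscillating_grids r : refining (oscillating_grids r).
Proof.
move=> n n1; have [no|ne] := boolP (odd n).
  have [j nE] : exists j, n = j.*2.+1.
    by exists n./2; rewrite -[LHS]odd_double_half no.
  have -> : n = (2 * j.+1 - 1)%N by lia.
  rewrite oscillating_grids_odd// (_ : (_ - 1).+1 = (2 * j.+1)%N); last by lia.
  by rewrite oscillating_grids_even [X in dyadic_grid X]mulSn addnC shifted_sub_dyadic.
have [j nE] : exists j, n = j.*2.
  by exists n./2; rewrite -[LHS]odd_double_half (negbTE ne).
have -> : n = (2 * j)%N by lia.
rewrite oscillating_grids_even (_ : (2 * j).+1 = (2 * j.+1 - 1)%N); last by lia.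
by rewrite oscillating_grids_odd// dyadic_sub_shifted.
Qed.

Lemma mesh_oscillating_grids r : (0 < r)%N ->
  mesh (oscillating_grids r n) @[n --> \oo] --> (0 : R).
Proof.
move=> r0.
have half0 : 2 ^- (n./2) @[n --> \oo] --> (0 : R).
  have : (fun n : nat => n./2) @ \oo --> \oo.
    by apply: cvg_infty_of_ge => n; rewrite -{1}[n]odd_double_half -muln2; case: (odd n); lia.
  move=> hh; rewrite (_ : (fun n : nat => _) = (fun m : nat => (2^-1 : R) ^+ m) \o (fun n => n./2)).
    by apply: (cvg_comp _ _ hh); apply: cvg_expr; rewrite ger0_norm; lra.
  by apply/funext => n /=; rewrite exprVn.
apply: (squeeze_cvgr _ (@cvg_cst R 0 _ _ _) half0); apply: nearW => n.
rewrite mesh_ge0 /=.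
have mono m : (n./2 <= m)%N -> 2 ^- m <= 2 ^- (n./2) :> R.
  by move=> nm; rewrite lef_pV2 ?posrE ?exprn_gt0// ler_eXn2l ?ltr1n.
rewrite /oscillating_grids; case: (odd n).
  apply: (le_trans (mesh_shifted_grid _ r0)); apply: mono.
  by apply: (@leq_trans (uphalf n)); [rewrite uphalf_half leq_addl|rewrite leq_pmulr].
apply: (le_trans (mesh_dyadic_grid _)); apply: mono.
by apply: (@leq_trans (n./2).+1) => //; rewrite leq_pmulr.
Qed.

Lemma not_cvg_oscillating (u : nat -> R) (l1 l2 : R) : l1 != l2 ->
  u (2 * j - 1)%N @[j --> \oo] --> l1 -> u (2 * j)%N @[j --> \oo] --> l2 ->
  ~ cvgn u.
Proof.
move=> l12 h1 h2 /cvg_ex[l ul]; move/eqP: l12; apply.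
have o1 : (fun j => (2 * j - 1)%N) @ \oo --> \oo by apply: cvg_infty_of_ge => n; lia.
have o2 : (fun j => (2 * j)%N) @ \oo --> \oo by apply: cvg_infty_of_ge => n; lia.
have e1 := cvg_comp _ _ o1 ul; have e2 := cvg_comp _ _ o2 ul.
by rewrite (cvg_unique _ h1 e1)// (cvg_unique _ h2 e2).
Qed.

End OscillatingGrids.

Section Main.
Context {R : realType}.
Variable H : R.
Hypothesis H01 : 0 < H < 1.
Local Notation p := H^-1.

(** Uniform convergence on [0, 1] is evaluated at time 1. *)
Lemma cvg_terminal_pvar (x : R -> R) (pi_ : nat -> {fset R}) :
  has_continuous_pvar p x pi_ -> cvgn (fun n => terminal_pvar p x (pi_ n)).
Proof.
move=> [v _ unif]; apply/cvg_ex; exists (v 1).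
have sub : [set (1 : R)] `<=` `[0, 1] by move=> t ->; rewrite /= in_itv /= lexx ler01.
have := uniform_subset_cvg _ sub unif.
by rewrite uniform_set1 => h; exact: h.
Qed.

Section Paths.
Context {d : measure_display} {T : measurableType d}.
Variables (P : probability T R)
  (theta : forall n : nat, 'I_(2 ^ n) -> {RV P >-> R}).
Hypothesis rad_theta : rademacher_signs theta.
Local Notation Y := (heap_signs theta).

(** As soon as the signs are +-1, the dyadic sums do not depend on them. *)
Lemma terminal_pvar_dyadic_grid w n :
  (forall i, Y i w = sign_of (coins Y w i)) ->
  terminal_pvar p (takagi_bridge H theta w) (dyadic_grid n) =
  2 `^ (1 - p) * iter n (signavg (2 `^ (H - 1))) (power_mean p) 0.
Proof.
move=> hw; rewrite (takagi_bridgeE _ hw) pvar_dyadic_grid// slope_mean//.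
by move=> m k _; exact: coin_field_sign.
Qed.

(** The squared distances of the sums to their deterministic means have integrals
    O(2^-n), so they tend to 0 almost surely. *)
Lemma ae_cvg_terminal_pvar_shifted_grid r : (0 < r)%N ->
  {ae P, forall w, terminal_pvar p (takagi_bridge H theta w) (shifted_grid r n)
     @[n --> \oo] --> 2 `^ (1 - p) * cell_moment H r}.
Proof.
move=> r0; have radY := rademacher_heap_signs rad_theta.
have [M M0 hM] := cell_average_variance H01 r.
pose u n w := (cell_average H r n (coins Y w) - cell_mean_average H r n) ^+ 2.
have loc n : first_coins_only (2 ^ (n + r))
    (fun b => (cell_average H r n b - cell_mean_average H r n) ^+ 2).
  by move=> b b' bb'; rewrite (eq_cell_average H bb').
have u0 : {ae P, forall w, u n w @[n --> \oo] --> (0 : R)}.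
  apply: (ae_cvg0_of_summable_integral (c := M)).
  - by move=> n; exact: (measurable_first_coins Y (loc n)).
  - by move=> n w; exact: sqr_ge0.
  - move=> n; rewrite /u (integral_first_coins radY (loc n)) ?lee_fin//.
    by move=> b; exact: sqr_ge0.
apply: filterS2 u0 (ae_sign_of_coins radY) => w uw hw.
rewrite (takagi_bridgeE _ hw).
under eq_fun do rewrite pvar_shifted_grid//.
apply: cvgMr.
have d0 : cell_average H r n (coins Y w) - cell_mean_average H r n
    @[n --> \oo] --> (0 : R).
  have hs : Num.sqrt (u n w) @[n --> \oo] --> Num.sqrt (0 : R).
    by apply: (cvg_comp _ _ uw); exact: sqrt_continuous.
  apply: norm_cvg0; rewrite sqrtr0 in hs.
  by under eq_fun do rewrite -sqrtr_sqr.
rewrite (_ : (fun n => _) = (fun n => (cell_average H r n (coins Y w) -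
    cell_mean_average H r n) + cell_mean_average H r n)).
  by rewrite -[X in _ --> X]add0r; exact: (cvgD d0 (@cvg_cell_moment _ H H01 r)).
by apply/funext => n; rewrite subrK.
Qed.

End Paths.

End Main.

Theorem theorem2p7 (R : realType) (H : R) (H01 : 0 < H < 1)
    (Hhalf : H != 1 / 2) :
  let p := H^-1 in
  exists (r : nat) (Cr : R) (piH : nat -> {fset R}),
    [/\ (1 <= r)%N,
        (forall j : nat, (1 <= j)%N ->
           piH (2 * j - 1)%N = shifted_grid r (j * r) /\
           piH (2 * j)%N = dyadic_grid (j.+1 * r)),
        (forall n : nat, (1 <= n)%N -> is_partition (piH n)),
        refining piH &
        (mesh (piH n) @[n --> \oo] --> (0 : R))]
    /\
    (forall (d' : measure_display) (T' : measurableType d')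
        (P' : probability T' R) (Y : nat -> {RV P' >-> R}),
       rademacher_family Y ->
       (H < 1 / 2 -> C_dyad H Y < Cr) /\ (1 / 2 < H -> Cr < C_dyad H Y))
    /\
    (forall (d : measure_display) (T : measurableType d)
        (P : probability T R)
        (theta : forall n : nat, 'I_(2 ^ n) -> {RV P >-> R}),
       rademacher_signs theta ->
       let X := takagi_bridge H theta in
       [/\ {ae P, forall w,
              ~ cvgn (fun n => terminal_pvar p (X w) (piH n))},
           {ae P, forall w, ~ has_continuous_pvar p (X w) piH},
           {ae P, forall w,
              terminal_pvar p (X w) (shifted_grid r n) @[n --> \oo] --> Cr},
           {ae P, forall w,
              terminal_pvar p (X w) (piH (2 * j - 1)%N) @[j --> \oo]
                --> Cr} &
           (forall (d' : measure_display) (T' : measurableType d')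
               (P' : probability T' R) (Y : nat -> {RV P' >-> R}),
              rademacher_family Y ->
              {ae P, forall w,
                 terminal_pvar p (X w) (piH (2 * j)%N) @[j --> \oo]
                   --> C_dyad H Y})]).
Proof.
move=> p.
have [r r0 [Clt Cgt]] := exists_cell_moment_neq H01.
have c0 : 0 < 2 `^ (1 - p) :> R by rewrite powR_gt0.
exists r, (2 `^ (1 - p) * cell_moment H r), (oscillating_grids r).
split.
  split=> //.
  - move=> j j1; split; first exact: oscillating_grids_odd.
    exact: oscillating_grids_even.
  - by move=> n _; exact: is_partition_oscillating_grids.
  - exact: refining_oscillating_grids.
  - exact: mesh_oscillating_grids.
split.
  move=> d' T' P' Y radY; rewrite (C_dyadE H01 radY).
  by split=> h; rewrite ltr_pM2l//; [exact: Clt|exact: Cgt].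
move=> d T P theta rad_theta X.
have good := ae_sign_of_coins (rademacher_heap_signs rad_theta).
have shifted := ae_cvg_terminal_pvar_shifted_grid H01 rad_theta r0.
have odd_cvg w : terminal_pvar p (X w) (shifted_grid r n) @[n --> \oo]
      --> 2 `^ (1 - p) * cell_moment H r ->
    terminal_pvar p (X w) (oscillating_grids r (2 * j - 1)%N) @[j --> \oo]
      --> 2 `^ (1 - p) * cell_moment H r.
  move=> h.
  have hc : terminal_pvar p (X w) (shifted_grid r (j * r)) @[j --> \oo]
      --> 2 `^ (1 - p) * cell_moment H r.
    exact: (cvg_comp _ _ (@cvg_mulnr r r0) h).
  apply: cvg_trans hc.
  apply: near_eq_cvg; near=> j => /=.
  rewrite oscillating_grids_odd//; near: j; exact: nbhs_infty_gt.
have even_cvg w : (forall i, heap_signs theta i w = sign_of (coins (heap_signs theta) w i)) ->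
    terminal_pvar p (X w) (oscillating_grids r (2 * j)%N) @[j --> \oo]
      --> 2 `^ (1 - p) * bernoulli_moment H.
  move=> hw; under eq_fun do rewrite oscillating_grids_even (terminal_pvar_dyadic_grid H01 _ hw).
  apply: cvgMr.
  have o : (fun j => (j.+1 * r)%N) @ \oo --> \oo.
    by apply: cvg_infty_of_ge => n; nia.
  exact: (cvg_comp _ _ o (cvg_bernoulli_moment H01)).
have ne : 2 `^ (1 - p) * cell_moment H r != 2 `^ (1 - p) * bernoulli_moment H.
  rewrite (inj_eq (mulfI (lt0r_neq0 c0))).
  have [/Clt h|] := ltP H (1 / 2); first by rewrite gt_eqF.
  by rewrite le_eqVlt eq_sym (negbTE Hhalf) => /Cgt h; rewrite lt_eqF.
have diverges : {ae P, forall w,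
    ~ cvgn (fun n => terminal_pvar p (X w) (oscillating_grids r n))}.
  apply: filterS2 shifted good => w sw hw.
  exact: not_cvg_oscillating ne (odd_cvg _ sw) (even_cvg _ hw).
split=> //.
- by apply: filterS diverges => w h /cvg_terminal_pvar.
- by apply: filterS shifted => w; exact: odd_cvg.
- move=> d' T' P' Y radY; rewrite (C_dyadE H01 radY).
  by apply: filterS good => w; exact: even_cvg.
Unshelve. all: by end_near. Qed.
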